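(* Let $m\ge1$ and let $\phi_1,\dots,\phi_m$ be real numbers with $\phi_1\notin\mathbb{Z}$, $\phi_m\notin\mathbb{Z}$ and $\phi_1+\dots+\phi_m\notin\mathbb{Z}$. Put $y_{i,j}=y_i-y_j$. Then the following identity of formal power series in $y_1,\dots,y_m$ holds: \begin{align*} &\sum_{j=0}^m(-1)^j e(\phi_1+\dots+\phi_j)\,\mathcal{L}i^t(\phi_{j+1},\dots,\phi_m\mid y_{j+1},\dots,y_m)\,\mathcal{L}i^t(-\phi_j,\dots,-\phi_1\mid -y_j,\dots,-y_1)\\ &=\frac{1}{2^{m-1}}\sum_{j=1}^m(-1)^{j-1}\mathcal{L}i(-\phi_{j-1},\dots,-\phi_1\mid\tfrac12y_{j,j-1},\dots,\tfrac12y_{j,1})\,B^t(\phi_1+\dots+\phi_m\mid y_j)\,\mathcal{L}i(\phi_{j+1},\dots,\phi_m\mid\tfrac12y_{j+1,j},\dots,\tfrac12y_{m,j}). \end{align*}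
   Context: $e(x)=\exp(2\pi ix)$. For $|\varepsilon_i|=1$ and positive integers $n_i$ with $(\varepsilon_m,n_m)\ne(1,1)$, the (convergent) series $\zeta\binom{\varepsilon_1,\dots,\varepsilon_m}{n_1,\dots,n_m}=\sum_{0<k_1<\dots<k_m}\prod_i\varepsilon_i^{k_i}k_i^{-n_i}$ and $t\binom{\varepsilon_1,\dots,\varepsilon_m}{n_1,\dots,n_m}=\sum_{0<k_1<\dots<k_m}\prod_i\varepsilon_i^{k_i}(2k_i-1)^{-n_i}$ (limits of the partial sums with $k_m\le M$ as $M\to\infty$). For $\phi_m\notin\mathbb{Z}$: $\mathcal{L}i(\phi_1,\dots,\phi_m\mid y_1,\dots,y_m)=\sum_{n_i\ge1}\zeta\binom{e(\phi_1),\dots,e(\phi_m)}{n_1,\dots,n_m}y_1^{n_1-1}\cdots y_m^{n_m-1}$ and $\mathcal{L}i^t$ likewise with $t$; a series with an empty argument list equals $1$. For $\phi\notin\mathbb{Z}$, $B^t(\phi\mid y)$ is the formal power series whose coefficient of $y^n$ ($n\ge0$) is $\lim_{M\to\infty}\sum_{k=-M}^{M}e(k\phi)(2k-1)^{-n-1}$. *)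

(* Defs.v *)
From mathcomp Require Import all_boot all_order all_algebra complex.
From mathcomp Require Import all_classical all_reals all_analysis.
(* The notations of mpoly clash with those of the analysis library. *)
From mathcomp Require Import -(notations) mpoly.

Set Implicit Arguments.
Unset Strict Implicit.
Unset Printing Implicit Defensive.

Import Order.TTheory GRing.Theory Num.Theory.
Import numFieldNormedType.Exports.

Local Open Scope ring_scope.
Local Open Scope complex_scope.

Section FormalPowerSeries.
Variable K : comNzRingType.

(* A formal power series in k variables is its family of coefficients. *)
Definition fps (k : nat) : Type := multinom k -> K.

(* Cauchy product; the summation range is that of the library's [mcoeffM] for
   the product of multivariate polynomials. *)
Definition fps_mul (k : nat) (F G : fps k) : fps k := fun nu =>
  \sum_(ab : bmultinom k (mdeg nu).+1 * bmultinom k (mdeg nu).+1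
        | nu == mnm_add ab.1 ab.2)
     F ab.1 * G ab.2.

(* F(l_1, ..., l_k) for polynomials l_i in y_1, ..., y_m WITHOUT CONSTANT TERM
   (below they are always linear forms).  The product of the l_i ^ (n_i) then
   has no term of degree less than |n|, so the coefficient of y^nu of the
   infinite sum only involves the exponents n with |n| <= |nu|. *)
Definition fps_subst (k m : nat) (F : fps k) (l : 'I_k -> mpoly m K) : fps m :=
  fun nu =>
    \sum_(n : bmultinom k (mdeg nu).+1)
       F n * mcoeff nu (\prod_(i < k) l i ^+ n i).

(* The list of variables y_1, ..., y_m. *)
Definition yvars (m : nat) : seq (mpoly m K) :=
  [seq mpolyX K (mnm1 i) | i <- enum 'I_m].

End FormalPowerSeries.

Section Series.
Variable R : realType.

(* exp(2 pi i x) *)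
Definition e (x : R) : R[i] := cos (2 * pi * x) +i* sin (2 * pi * x).

(* Limit of a complex sequence.  The cast makes the library find the topology
   that [R[i]] carries as a [numFieldType]. *)
Definition climit (u : nat -> (R[i] : numFieldType)) : R[i] :=
  lim (u @ \oo)%classic.

(* sum over 0 < k_1 < ... < k_m <= M of prod_i eps_i ^ k_i / d(k_i) ^ n_i *)
Definition nested_sum (d : nat -> nat) (m : nat) (eps : 'I_m -> R[i])
    (n : 'I_m -> nat) (M : nat) : R[i] :=
  \sum_(k : m.-tuple 'I_M.+1 | path ltn 0%N (map val k))
     \prod_(i < m) (eps i ^+ tnth k i / (d (tnth k i))%:R ^+ n i).

Definition mzv (m : nat) (eps : 'I_m -> R[i]) (n : 'I_m -> nat) : R[i] :=
  climit (nested_sum (fun k => k) eps n).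

(* The truncated subtraction is harmless: only k > 0 occurs in the sum. *)
Definition mtv (m : nat) (eps : 'I_m -> R[i]) (n : 'I_m -> nat) : R[i] :=
  climit (nested_sum (fun k => 2 * k - 1)%N eps n).

Definition Li_fps (phi : seq R) : fps R[i] (size phi) := fun nu =>
  mzv (fun i : 'I_(size phi) => e phi`_i) (fun i => (nu i).+1).

Definition Lit_fps (phi : seq R) : fps R[i] (size phi) := fun nu =>
  mtv (fun i : 'I_(size phi) => e phi`_i) (fun i => (nu i).+1).

#[local] Arguments Li_fps phi nu : clear implicits.
#[local] Arguments Lit_fps phi nu : clear implicits.

Definition Bt_fps (phi : R) : fps R[i] 1 := fun nu =>
  climit (fun M : nat =>
    \sum_(i < (2 * M).+1)
       let k : int := i%:Z - M%:Z in
       e (k%:~R * phi) / ((2 * k - 1)%:~R ^+ (nu ord0).+1)).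

(* Li(phi_1, ..., phi_k | l_1, ..., l_k), as a series in y_1, ..., y_m; the two
   lists are meant to have the same length.  For empty lists this is the
   series 1, the only 0-tuple contributing an empty product. *)
Definition Li (m : nat) (phi : seq R) (l : seq (mpoly m R[i])) : fps R[i] m :=
  fps_subst (Li_fps phi) (fun i => l`_i).

Definition Lit (m : nat) (phi : seq R) (l : seq (mpoly m R[i])) : fps R[i] m :=
  fps_subst (Lit_fps phi) (fun i => l`_i).

Definition Bt (m : nat) (phi : R) (l : mpoly m R[i]) : fps R[i] m :=
  fps_subst (Bt_fps phi) (fun=> l).

End Series.

Arguments Li_fps {R} phi nu.
Arguments Lit_fps {R} phi nu.
Arguments Li {R m} phi l nu.
Arguments Lit {R m} phi l nu.
Arguments Bt {R m} phi l nu.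

(* Main.v *)
From HB Require Import structures.
Require Import Defs.
From mathcomp Require Import all_boot all_order all_algebra complex.
From mathcomp Require Import all_classical all_reals all_analysis.
From mathcomp Require Import -(notations) mpoly.
From mathcomp Require Import zify ring lra.

Set Implicit Arguments.
Unset Strict Implicit.
Unset Printing Implicit Defensive.

Import Order.TTheory GRing.Theory Num.Theory.

Local Open Scope ring_scope.
Local Open Scope complex_scope.

(* With [k -> 1 - k] in the second factor, the [j]-th term of the left-hand side
   is the sum of [prod_i e(phi_i k_i) / (2 k_i - 1 - y_i)] over the chains
   [k_1 < ... < k_m] of integers with [k_j <= 0 < k_(j+1)], so that the left-hand
   side is the sum over all chains.  Put [a_i = 2 k_i - 1 - y_i].  The partial
   fraction expansion
     [prod_i 1 / a_i = sum_j 1 / a_j * prod_(i <> j) 1 / (a_i - a_j)],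
   where [a_i - a_j = 2 (k_i - k_j - (y_i - y_j) / 2)], turns it into the
   right-hand side by summing over [k_j] and over the differences [k_i - k_j].
   For chains in [(-M, M]] this is an identity between finite sums, but there
   the differences run up to [k_j + M - 1] and [M - k_j] only.  By Abel summation
   these partial sums converge at rate [O(N^(-1/2))], and as
   [sum_(k <= M) 1 / (k sqrt (M + 1 - k))] tends to 0, they can be replaced by their
   limits when [M] tends to infinity. *)

(** * Sums over increasing chains *)

Section ChainSum.
Variable V : nmodType.
Implicit Types (a b m : nat) (F : seq nat -> V).

(** The weights [1 / |2 k_j - 1|] in the sum over [k_j] have a logarithmically divergent sum, so
    mere convergence of the sums over the differences does not justify replacing them by their
    limits: a rate is needed. What saves the argument is that a range of differences is short only
    when [|k_j|] is close to [M], where the weight is about [1 / M]. The exponent [-1/2] is far from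
    sharp: nested sums of terms [1 / k] grow like powers of [log N], and bounding them by multiples
    of [sqrt N] keeps logarithms out of all estimates while leaving enough decay. Non-integrality
    enters only through Abel summation: the last argument of every nested series is [phi_m] or
    [- phi_1], and that of [B^t] is [phi_1 + ... + phi_m]. Coefficients of degree at most a fixed
    [D] are treated. Modulo higher terms [1 / (c - l)] is a finite geometric sum, hence a
    polynomial; the partial fractions therefore live in a quotient of a polynomial ring, in general
    not a field, and are proved from explicitly given inverses. *)

Fixpoint chain_sum a b m F : V :=
  if m is m'.+1 then
    \sum_(a.+1 <= k < b.+1) chain_sum k b m' (fun s => F (k :: s))
  else F [::].

Lemma eq_chain_sum a b m F G :
    (forall s, size s = m -> path ltn a s -> all (fun k => k <= b)%N s ->
      F s = G s) ->
  chain_sum a b m F = chain_sum a b m G.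
Proof.
elim: m a F G => [|m IH] a F G FG /=; first exact: FG.
apply: eq_big_nat => k /andP[ak kb]; apply: IH => s sm ks sb.
by apply: FG; rewrite /= ?sm ?ak ?ks ?sb ?andbT.
Qed.

Lemma chain_sum_sum a b m (I : Type) (r : seq I) (P : pred I)
    (F : I -> seq nat -> V) :
  chain_sum a b m (fun s => \sum_(i <- r | P i) F i s)
  = \sum_(i <- r | P i) chain_sum a b m (F i).
Proof.
elim: m a F => [|m IH] a F //=; rewrite exchange_big /=.
by apply: eq_bigr => k _; rewrite IH.
Qed.

(** A chain is classified by the number [j] of its entries that are at most [c]; [j = 0] collects
    the chains that start beyond [c]. *)
Lemma chain_sum_cat a c b m F : (a <= c <= b)%N ->
  chain_sum a b m F =
  \sum_(j < m.+1) chain_sum a c j (fun s =>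
     chain_sum c b (m - j) (fun t => F (s ++ t))).
Proof.
move=> /andP[]; elim: m a F => [|m IH] a F ac cb /=.
  by rewrite big_ord_recl big_ord0 addr0.
rewrite big_ord_recl /= addrC (@big_cat_nat _ _ _ c.+1) //=; congr (_ + _).
rewrite exchange_big /=; apply: eq_big_nat => k /andP[ak kc].
by rewrite IH //; apply: eq_bigr => i _; rewrite /bump /= add1n subSS.
Qed.

Lemma sum_nat_triangle a b (F : nat -> nat -> V) :
  \sum_(a <= i < b) \sum_(i.+1 <= j < b) F i j
  = \sum_(a <= j < b) \sum_(a <= i < j) F i j.
Proof.
rewrite -[LHS]/(\sum_(a <= i < b | xpredT i) _).
transitivity (\sum_(a <= i < b) \sum_(a <= j < b | (i < j)%N) F i j).
  apply: eq_big_nat => i /andP[ai ib].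
  by rewrite (big_nat_widenl i.+1 a) 1?ltnW //; apply: eq_bigl => j.
rewrite (exchange_big_dep_nat xpredT) //=; apply: eq_big_nat => j /andP[aj jb].
by rewrite [RHS](big_nat_widen _ _ b) 1?ltnW //; apply: eq_bigl => i.
Qed.

(** Fixing the entry in position [p] leaves two independent chains, one in [(a, k - 1]] and one in
    [(k, b]]. The induction peels off the first entry; [sum_nat_triangle] then moves the pivot to
    the outside. *)
Lemma chain_sum_mid a b p q F :
  chain_sum a b (p + q.+1) F =
  \sum_(a.+1 <= k < b.+1) chain_sum a k.-1 p (fun s =>
     chain_sum k b q (fun t => F (s ++ k :: t))).
Proof.
elim: p a F => [|p IH] a F //=.
under eq_big_nat => k _ do rewrite IH.
rewrite sum_nat_triangle; apply: eq_big_nat => k /andP[ak _].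
by rewrite prednK // (leq_trans _ ak).
Qed.

Lemma chain_sum_rcons a b m F :
  chain_sum a b m.+1 F =
  \sum_(a.+1 <= k < b.+1) chain_sum a k.-1 m (fun s => F (rcons s k)).
Proof.
rewrite -addn1 chain_sum_mid /=; apply: eq_big_nat => k _.
by apply: eq_chain_sum => s *; rewrite cats1.
Qed.

(** The reflection [k -> c + 1 - k] reverses the order, so a reflected chain is again increasing
    once read backwards; [b <= c] keeps the subtractions from being truncated. *)
Lemma chain_sum_rev a b c m F : (a <= b <= c)%N ->
  chain_sum a b m F =
  chain_sum (c - b) (c - a) m (fun s => F (rev (map (subn c.+1) s))).
Proof.
elim: m a F => [|m IH] a F /andP[ab bc] //.
rewrite [RHS]chain_sum_rcons [RHS]big_rev_mkord /= -{1}[a.+1]add0n.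
rewrite big_addn big_mkord subSS.
rewrite (_ : ((c - a).+1 - _ = b - a)%N); last by lia.
apply: eq_bigr => -[i /= ltib] _; rewrite IH; last by lia.
rewrite (_ : (c - (i + a.+1) = ((c - a).+1 - i.+1).-1)%N); last by lia.
apply: eq_chain_sum => s _ _ _; rewrite map_rcons rev_rcons.
by congr (F (_ :: _)); lia.
Qed.

Lemma chain_sum_shift a b c m F :
  chain_sum (a + c) (b + c) m F = chain_sum a b m (fun s => F (map (addn^~ c) s)).
Proof.
elim: m a F => [|m IH] a F //=.
rewrite -!addSn big_addn addnK; apply: eq_big_nat => k _.
exact: IH.
Qed.

End ChainSum.

(** The bridge from the tuples of [nested_sum] to the recursive form, on which inductions are
    direct. *)
Lemma chain_sum_tuple (V : nmodType) (m M : nat) (F : seq nat -> V) a :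
  \sum_(k : m.-tuple 'I_M.+1 | path ltn a (map val k)) F (map val k)
  = chain_sum a M m F.
Proof.
elim: m a F => [|m IH] a F.
  by rewrite (big_pred1 [tuple]) //= => t; rewrite [t]tuple0 /=; apply/esym/eqP.
pose h (x : 'I_M.+1 * m.-tuple 'I_M.+1) := [tuple of x.1 :: x.2].
rewrite (reindex h) /=; last first.
  exists (fun t => (thead t, [tuple of behead t])) => [[x t] _|t _].
    by rewrite /h theadE; congr (_, _); apply: val_inj.
  by rewrite /h -tuple_eta.
rewrite -(pair_big_dep (fun k : 'I_M.+1 => (a < k)%N)
   (fun (k : 'I_M.+1) (t : m.-tuple 'I_M.+1) => path ltn k (map val t))
   (fun (k : 'I_M.+1) (t : m.-tuple 'I_M.+1) => F ((k : nat) :: map val t))) /=.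
under eq_bigr => k _ do rewrite (IH k (fun s => F ((k : nat) :: s))).
rewrite -(big_mkord (fun k => a < k)%N (fun k => chain_sum k M m (fun s => F (k :: s)))).
by rewrite [RHS](big_nat_widenl _ 0) //; apply: eq_bigl => j.
Qed.

Lemma chain_sum_raddf (V W : nmodType) (f : {additive V -> W}) a b m (F : seq nat -> V) :
  f (chain_sum a b m F) = chain_sum a b m (fun s => f (F s)).
Proof.
elim: m a F => [|m IH] a F //=; rewrite raddf_sum /=.
by apply: eq_bigr => k _; apply: IH.
Qed.

Lemma chain_sumMl (A : pzSemiRingType) a b m x (F : seq nat -> A) :
  chain_sum a b m (fun s => x * F s) = x * chain_sum a b m F.
Proof.
elim: m a F => [|m IH] a F //=; rewrite mulr_sumr.
by apply: eq_bigr => k _; apply: IH.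
Qed.

Lemma chain_sumMr (A : pzSemiRingType) a b m x (F : seq nat -> A) :
  chain_sum a b m (fun s => F s * x) = chain_sum a b m F * x.
Proof.
elim: m a F => [|m IH] a F //=; rewrite mulr_suml.
by apply: eq_bigr => k _; apply: IH.
Qed.

Lemma chain_sumZ (A : pzRingType) (V : lmodType A) a b m x (F : seq nat -> V) :
  chain_sum a b m (fun s => x *: F s) = x *: chain_sum a b m F.
Proof.
elim: m a F => [|m IH] a F //=; rewrite scaler_sumr.
by apply: eq_bigr => k _; apply: IH.
Qed.

(** * Chains weighted by a product of one factor per entry *)

Section ChainProd.
Variable A : comNzRingType.
Implicit Types (T : nat -> nat -> A) (a b c n : nat).

Definition chain_prod a b n T : A :=
  chain_sum a b n (fun s => \prod_(0 <= i < n) T i (nth 0%N s i)).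

Lemma path_ltn_nth_gt a (s : seq nat) i :
  path ltn a s -> (i < size s)%N -> (a < nth 0%N s i)%N.
Proof. by move=> /(order_path_min ltn_trans)/all_nthP; apply. Qed.

Lemma eq_chain_prod a b n T T' :
    (forall i k, (i < n)%N -> (a < k <= b)%N -> T i k = T' i k) ->
  chain_prod a b n T = chain_prod a b n T'.
Proof.
move=> TT; apply: eq_chain_sum => s sn sa /all_nthP sb.
apply: eq_big_nat => i /andP[_ lin]; apply: TT => //.
by rewrite path_ltn_nth_gt ?sb ?sn.
Qed.

Lemma prod_nth_cat n j s t T : (j <= n)%N -> size s = j ->
  \prod_(0 <= i < n) T i (nth 0%N (s ++ t) i) =
  (\prod_(0 <= i < j) T i (nth 0%N s i)) *
  (\prod_(0 <= i < n - j) T (i + j)%N (nth 0%N t i)).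
Proof.
move=> jn sj; rewrite (@big_cat_nat _ _ _ j) //=; congr (_ * _).
  by apply: eq_big_nat => i /= ij; rewrite nth_cat sj ij.
rewrite -{1}[j]add0n big_addn; apply: eq_big_nat => i _.
by rewrite nth_cat sj ltnNge leq_addl addnK.
Qed.

Lemma chain_prod_cat a c b n T : (a <= c <= b)%N ->
  chain_prod a b n T =
  \sum_(j < n.+1) chain_prod a c j T *
                  chain_prod c b (n - j) (fun i => T (i + j)%N).
Proof.
move=> acb; rewrite /chain_prod (chain_sum_cat _ _ acb); apply: eq_bigr => j _.
rewrite -chain_sumMr; apply: eq_chain_sum => s sj _ _; rewrite -chain_sumMl.
by apply: eq_chain_sum => t _ _ _; rewrite (@prod_nth_cat _ j) // -ltnS.
Qed.

Lemma chain_prod_shift a b c n T :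
  chain_prod (a + c) (b + c) n T = chain_prod a b n (fun i k => T i (k + c)%N).
Proof.
rewrite /chain_prod chain_sum_shift; apply: eq_chain_sum => s sn _ _.
by apply: eq_big_nat => i /andP[_ lin]; rewrite (nth_map 0%N) ?sn.
Qed.

Lemma chain_prod_rev a b c n T : (a <= b <= c)%N ->
  chain_prod a b n T =
  chain_prod (c - b) (c - a) n (fun i k => T (n - i.+1)%N (c.+1 - k)%N).
Proof.
move=> abc; rewrite /chain_prod (chain_sum_rev _ _ abc).
apply: eq_chain_sum => s sn _ _; rewrite big_nat_rev; apply: eq_big_nat => i /andP[_ lin].
rewrite add0n nth_rev size_map sn; last by lia.
by rewrite (nth_map 0%N) ?sn; [congr (T _ (_ - nth _ _ _)%N)|]; lia.
Qed.

(** After partial fractions every factor involves one entry and the pivot only, so for a fixed pivot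
    the sum splits into a left and a right one. *)
Lemma chain_prod_mid a b p q (L S : nat -> nat -> nat -> A) (C : nat -> A) :
  chain_sum a b (p + q.+1) (fun s =>
    (\prod_(0 <= i < p) L (nth 0%N s p) i (nth 0%N s i)) * C (nth 0%N s p) *
    \prod_(p.+1 <= i < p + q.+1) S (nth 0%N s p) i (nth 0%N s i)) =
  \sum_(a.+1 <= k < b.+1) chain_prod a k.-1 p (L k) * C k *
     chain_prod k b q (fun i => S k (i + p.+1)%N).
Proof.
rewrite chain_sum_mid; apply: eq_big_nat => k _.
rewrite -!chain_sumMr; apply: eq_chain_sum => s sp _ _.
rewrite -chain_sumMl; apply: eq_chain_sum => t tq _ _.
rewrite nth_cat sp ltnn subnn /=; congr (_ * _ * _).
  by apply: eq_big_nat => i /= lip; rewrite nth_cat sp lip.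
rewrite -{1}[p.+1]add0n big_addn addnS subSS addKn; apply: eq_big_nat => i _.
rewrite nth_cat sp ltnNge (_ : (p <= _)%N) /=; last by lia.
by rewrite (_ : (i + p.+1 - p)%N = i.+1) //; lia.
Qed.

End ChainProd.

Lemma chain_prodZ (K : comNzRingType) (A : comAlgType K) a b n
    (w : nat -> K) (T : nat -> nat -> A) :
  chain_prod a b n (fun i k => w i *: T i k) =
  (\prod_(0 <= i < n) w i) *: chain_prod a b n T.
Proof.
rewrite /chain_prod -chain_sumZ; apply: eq_chain_sum => s _ _ _.
exact: scaler_prod.
Qed.

Lemma chain_prod_recr (A : comNzRingType) a b n (T : nat -> nat -> A) :
  chain_prod a b n.+1 T =
  \sum_(a.+1 <= k < b.+1) chain_prod a k.-1 n T * T n k.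
Proof.
rewrite /chain_prod chain_sum_rcons; apply: eq_big_nat => k _.
rewrite -chain_sumMr; apply: eq_chain_sum => s sn _ _.
rewrite big_nat_recr //= nth_rcons sn ltnn eqxx; congr (_ * _).
by apply: eq_big_nat => i /= lin; rewrite nth_rcons sn lin.
Qed.

(** * Power series modulo high degree *)

(** Induction on the number of factors, reduced to the case of two:
    [b_j b_(n+1) = c_(n+1,j) (b_j - b_(n+1))]. Inverses are data here because [A] need not be a
    field. *)
Lemma partial_fractions (A : comNzRingType) (n : nat) (a b : nat -> A)
    (c : nat -> nat -> A) :
    (forall i, (i < n.+1)%N -> b i * a i = 1) ->
    (forall i j, (i < n.+1)%N -> (j < n.+1)%N -> i != j ->
      c i j * (a i - a j) = 1) ->
  \prod_(0 <= i < n.+1) b i =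
  \sum_(0 <= j < n.+1)
     (\prod_(0 <= i < j) c i j) * b j * \prod_(j.+1 <= i < n.+1) c i j.
Proof.
elim: n a b => [|n IH] a b ba ca.
  by rewrite !big_nat1 !big_geq // mul1r mulr1.
have cN i : (i < n.+1)%N -> c i n.+1 = - c n.+1 i.
  move=> lin; have neq_in : i != n.+1 by rewrite ltn_eqF.
  have h1 : c i n.+1 * (a i - a n.+1) = 1 by apply: ca; rewrite // ltnS ltnW.
  have h2 : c n.+1 i * (a n.+1 - a i) = 1.
    by apply: ca; rewrite // 1?eq_sym // ltnS ltnW.
  transitivity (- c n.+1 i * (c i n.+1 * (a i - a n.+1))); last by rewrite h1 mulr1.
  by rewrite -[LHS]mulr1 -h2; ring.
rewrite big_nat_recr //= [RHS]big_nat_recr //= [X in _ = _ + X]mulrC.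
rewrite [X in _ = _ + X * _]big_geq // mul1r.
(* The last summand contains the product of the inverses of the [a i - a n.+1]. Their mutual
   differences are those of the [a i], so the induction hypothesis expands it with the same [c]. *)
rewrite [in RHS](IH (fun i => a i - a n.+1)); first last.
- move=> i j li lj ij; rewrite -(ca i j) ?(leqW li) ?(leqW lj) //.
  by ring.
- by move=> i li; apply: ca; rewrite ?ltn_eqF // leqW.
rewrite (IH a b); first last.
- by move=> i j li lj ij; apply: ca; rewrite // leqW.
- by move=> i li; apply: ba; rewrite leqW.
rewrite mulr_suml [X in _ = _ + X]mulr_suml -big_split /=.
apply: eq_big_nat => j /= lj.
rewrite [\prod_(j.+1 <= i < n.+2) _]big_nat_recr //=.
rewrite (cN j) //.
have hj : b j * a j = 1 by apply: ba; rewrite leqW.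
have hn : b n.+1 * a n.+1 = 1 by apply: ba.
have hc : c n.+1 j * (a n.+1 - a j) = 1.
  by apply: ca; [|exact: leqW|rewrite gtn_eqF].
have hjn : c n.+1 j * (b j - b n.+1) = b j * b n.+1.
  transitivity (c n.+1 j * (b j * (b n.+1 * a n.+1) - b n.+1 * (b j * a j))).
    by rewrite hn hj !mulr1.
  by rewrite -[RHS]mulr1 -hc; ring.
set L := \prod_(0 <= i < j) _; set S := \prod_(j.+1 <= i < _) _.
transitivity (L * S * (b j * b n.+1)); first by ring.
by rewrite -hjn; ring.
Qed.

(** * Polynomials modulo terms of degree above [D] *)

Section Truncation.
Variables (K : fieldType) (m D : nat).
Implicit Types (p q l : mpoly m K) (mu : multinom m).

Definition vanishing_below d p := forall mu, (mdeg mu < d)%N -> mcoeff mu p = 0.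

Lemma vanishing_belowM d1 d2 p q :
  vanishing_below d1 p -> vanishing_below d2 q -> vanishing_below (d1 + d2) (p * q).
Proof.
move=> vp vq mu lmu; rewrite mcoeffM big1 // => -[[a ha] [b hb]] /= /eqP mE.
have : (mdeg a < d1 \/ mdeg b < d2)%N by move: lmu; rewrite mE mdegD; lia.
by case=> [/vp->|/vq->]; rewrite ?mul0r ?mulr0.
Qed.

Lemma vanishing_belowX d p n : vanishing_below d p -> vanishing_below (n * d) (p ^+ n).
Proof.
move=> vp; elim: n => [|n IH]; first by [].
by rewrite exprS mulSn; apply: vanishing_belowM.
Qed.

Lemma vanishing_below_prod (I : finType) (d : I -> nat) (p : I -> mpoly m K) :
    (forall i, vanishing_below (d i) (p i)) ->
  vanishing_below (\sum_i d i) (\prod_i p i).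
Proof.
move=> vp; apply: (big_rec2 (fun d p => vanishing_below d p)) => // i d' p' _.
exact: vanishing_belowM.
Qed.

Lemma vanishing_below1 l : mcoeff (@mnm0 m) l = 0 -> vanishing_below 1 l.
Proof. by move=> l0 mu; rewrite ltnS leqn0 mdeg_eq0 => /eqP ->. Qed.

(* Modulo this ideal, [geo c l] below is the inverse of [c - l]. *)
Definition high : {pred mpoly m K} :=
  [pred p | [forall mu : bmultinom m D.+1, mcoeff mu p == 0]].

Lemma highP p : reflect (vanishing_below D.+1 p) (p \in high).
Proof.
apply: (iffP forallP) => [h mu lmu | h mu].
  by have /eqP := h (BMultinom lmu).
by apply/eqP/h/bmdeg.
Qed.

Lemma high_idealr_closed : idealr_closed high.
Proof.
split; first by apply/highP => mu _; rewrite mcoeff0.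
  apply/highP => /(_ (@mnm0 m)); rewrite mdeg0 mcoeff1 eqxx => /(_ isT)/eqP.
  by rewrite oner_eq0.
move=> a p q /highP hp /highP hq; apply/highP => mu lmu.
rewrite mcoeffD hq // addr0.
by apply: (@vanishing_belowM 0 D.+1).
Qed.

HB.instance Definition _ := isIdealr.Build (mpoly m K) high high_idealr_closed.

Lemma high_eqP p q :
  (\pi_({ideal_quot high}) p = \pi q)%qT <->
  forall mu, (mdeg mu <= D)%N -> mcoeff mu p = mcoeff mu q.
Proof.
split=> [/eqP|h].
  rewrite -Quotient.idealrBE => /highP h mu lmu.
  by apply/eqP; rewrite -subr_eq0 -mcoeffB h.
apply/eqP; rewrite -Quotient.idealrBE; apply/highP => mu lmu.
by rewrite mcoeffB h ?subrr.
Qed.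

Definition geo (c : K) l : mpoly m K := \sum_(n < D.+1) c ^- n.+1 *: l ^+ n.

Lemma geoP c l : c != 0 -> mcoeff (@mnm0 m) l = 0 ->
  (\pi_({ideal_quot high}) (geo c l * (c%:A - l)) = 1)%qT.
Proof.
move=> c0 l0; rewrite -[RHS](rmorph1 (\pi_({ideal_quot high})%qT)).
apply/high_eqP => mu lmu.
(* The geometric sum telescopes, and [l ^ (D + 1)] lies in the ideal because [l] has no constant
   term. *)
suff -> : geo c l * (c%:A - l) = 1 - c ^- D.+1 *: l ^+ D.+1.
  rewrite mcoeffB mcoeffZ.
  rewrite (vanishing_belowX (vanishing_below1 l0)) ?mulr0 ?subr0 //.
  by rewrite muln1.
rewrite /geo; elim: (D.+1) => [|n IH].
  by rewrite big_ord0 mul0r expr0 invr1 scale1r subrr.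
rewrite big_ord_recr /= mulrDl IH -scalerAl mulrBr scalerBr -scalerAr mulr1.
rewrite scalerA [in c ^- n.+1 * c]exprS invfM mulrAC mulVf // mul1r -exprSr.
by rewrite addrA subrK.
Qed.

End Truncation.

(** * Substitution as a coefficient of a polynomial *)

Section FpsPoly.
Variables (K : fieldType) (m D : nat).
Implicit Types (p q l : mpoly m K) (nu : multinom m).

(** Replaces the simplex of exponents of bounded total degree by a box, over which a product of sums
    can be expanded. The exponents added have total degree above that of [nu] and contribute 0. *)
Lemma fps_subst_ffun k (F : fps K k) (l : 'I_k -> mpoly m K) nu :
    (forall i, mcoeff (@mnm0 m) (l i) = 0) -> (mdeg nu <= D)%N ->
  fps_subst F l nu =
  \sum_(f : {ffun 'I_k -> 'I_D.+1})
     F (Multinom [tuple (f i : nat) | i < k]) * mcoeff nu (\prod_i l i ^+ f i).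
Proof.
move=> l0 lD; pose mf (f : {ffun 'I_k -> 'I_D.+1}) := Multinom [tuple (f i : nat) | i < k].
have mfE f i : mf f i = f i by rewrite mnmE.
rewrite (bigID (fun f => mdeg (mf f) < (mdeg nu).+1)%N) /= addrC big1 => [|f]; last first.
  rewrite -leqNgt => lf; rewrite (_ : mcoeff _ _ = 0) ?mulr0 //.
  apply: (vanishing_below_prod (d := fun i => f i)) => [i|].
    rewrite -[X in vanishing_below X]muln1; apply: vanishing_belowX.
    exact: vanishing_below1.
  rewrite (_ : (\sum_i _)%N = mdeg (mf f)) //.
  by rewrite mdegE; apply: eq_bigr => i _; rewrite mfE.
rewrite add0r /fps_subst.
have lm0 : (mdeg (@mnm0 k) < (mdeg nu).+1)%N by rewrite mdeg0.
pose h (b : bmultinom k (mdeg nu).+1) : {ffun 'I_k -> 'I_D.+1} :=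
  [ffun i => inord (b i)].
have lbi (b : bmultinom k (mdeg nu).+1) i : (b i < D.+1)%N.
  apply: leq_ltn_trans (leq_trans (bmdeg b) _) => //.
  by move: (bmnm b) => b'; rewrite mdegE (bigD1 i) //= leq_addr.
have hK b : mf (h b) = b.
  by apply/mnmP => i; rewrite mfE ffunE inordK.
rewrite [RHS](reindex_onto h (fun f => insubd (BMultinom lm0) (mf f))) /=.
  apply: eq_big => [b|b _]; last rewrite -/(mf (h b)) hK.
    rewrite /= hK bmdeg; apply/esym/eqP/val_inj.
    by rewrite val_insubd bmdeg.
  congr (_ * mcoeff _ _); apply: eq_bigr => i _.
  by rewrite ffunE inordK.
move=> f lf; apply/ffunP => i; apply: val_inj.
have fK : bmnm (insubd (BMultinom lm0) (mf f)) = mf f by exact: insubdK.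
by rewrite ffunE /= fK mfE inordK.
Qed.

(** Truncated form of [sum_n prod_i w_i l_i^(n_i) / x_i^(n_i + 1) = prod_i w_i / (x_i - l_i)]: a
    single chain contributes a product of geometric series. *)
Lemma fps_subst_prod k (w x : 'I_k -> K) (l : 'I_k -> mpoly m K) nu :
    (forall i, mcoeff (@mnm0 m) (l i) = 0) -> (mdeg nu <= D)%N ->
  fps_subst (fun n : multinom k => \prod_i (w i / x i ^+ (n i).+1)) l nu =
  mcoeff nu (\prod_i (w i *: geo D (x i) (l i))).
Proof.
move=> l0 lD; rewrite (fps_subst_ffun _ l0 lD).
under [X in mcoeff nu X]eq_bigr => i _ do rewrite /geo scaler_sumr.
rewrite bigA_distr_bigA /= raddf_sum /=; apply: eq_bigr => f _.
under [X in _ = mcoeff nu X]eq_bigr => i _ do rewrite scalerA.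
rewrite scaler_prod mcoeffZ; congr (_ * _).
by apply: eq_bigr => i _; rewrite mnmE.
Qed.

Lemma fps_subst_sum k (I : Type) (r : seq I) (P : pred I) (F : I -> fps K k)
    (l : 'I_k -> mpoly m K) nu :
  fps_subst (fun n => \sum_(i <- r | P i) F i n) l nu =
  \sum_(i <- r | P i) fps_subst (F i) l nu.
Proof.
by rewrite /fps_subst exchange_big /=; apply: eq_bigr => n _; rewrite mulr_suml.
Qed.

Lemma eq_fps_subst k (F G : fps K k) (l : 'I_k -> mpoly m K) nu :
  F =1 G -> fps_subst F l nu = fps_subst G l nu.
Proof. by move=> FG; apply: eq_bigr => n _; rewrite FG. Qed.

End FpsPoly.

Section TruncatedSeries.
Variables (R : realType) (m D : nat).

(* The part [k_i <= N] of [Li] (resp. [Lit]), modulo degree [D]. *)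
Definition chain_poly (d : nat -> nat) (k : nat) (eps : nat -> R[i])
    (l : nat -> mpoly m R[i]) (N : nat) : mpoly m R[i] :=
  chain_prod 0 N k (fun i j => eps i ^+ j *: geo D (d j)%:R (l i)).

Lemma fps_subst_nested_sum d k (eps : nat -> R[i]) (l : nat -> mpoly m R[i])
    N (nu : multinom m) :
    (forall i, (i < k)%N -> mcoeff (@mnm0 m) (l i) = 0) -> (mdeg nu <= D)%N ->
  fps_subst (fun n => nested_sum d (fun i : 'I_k => eps i) (fun i => (n i).+1) N)
    (fun i => l i) nu =
  mcoeff nu (chain_poly d k eps l N).
Proof.
move=> l0 lD; rewrite /chain_poly /chain_prod -chain_sum_tuple raddf_sum /= fps_subst_sum.
apply: eq_bigr => t _; rewrite (@fps_subst_prod _ _ D) //; last by move=> i; apply: l0.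
apply: (congr1 (mcoeff nu)); rewrite big_mkord.
apply: eq_bigr => i _.
have -> : nth 0%N (map val t) i = tnth t i; last by [].
by rewrite (nth_map ord0) ?size_tuple // (tnth_nth ord0).
Qed.

Lemma fps_subst_bilateral (I : Type) (r : seq I) (w x : I -> R[i])
    (l : mpoly m R[i]) (nu : multinom m) :
    mcoeff (@mnm0 m) l = 0 -> (mdeg nu <= D)%N ->
  fps_subst (fun n : multinom 1 => \sum_(i <- r) w i / x i ^+ (n ord0).+1)
    (fun=> l) nu =
  mcoeff nu (\sum_(i <- r) w i *: geo D (x i) l).
Proof.
move=> l0 lD; rewrite raddf_sum /= fps_subst_sum; apply: eq_bigr => i _.
rewrite (_ : w i *: _ = \prod_(j < 1) (w i *: geo D (x i) l)); last by rewrite big_ord1.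
rewrite -(fps_subst_prod (fun=> w i) (fun=> x i) (l := fun=> l)) //.
by apply: eq_fps_subst => n; rewrite big_ord1.
Qed.

End TruncatedSeries.

(** * The identity for finite sums *)

Section Exponential.
Variable R : realType.
Implicit Types x y : R.

Lemma e0 : e 0 = 1 :> R[i].
Proof. by rewrite /e mulr0 cos0 sin0. Qed.

Lemma eD x y : e (x + y) = e x * e y.
Proof.
apply/eqP; rewrite /e mulrDr cosD sinD eq_complex /=; apply/andP; split=> //.
by rewrite addrC mulrC [X in _ + X]mulrC; apply/eqP; ring.
Qed.

Lemma eN_mul x : e (- x) * e x = 1.
Proof. by rewrite -eD addNr e0. Qed.

Lemma eN x : e (- x) = (e x)^-1.
Proof.
have ex0 : e x != 0.
  by apply: contraTneq (oner_neq0 R[i]) => ex0; rewrite -(eN_mul x) ex0 mulr0 eqxx.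
by apply: (mulIf ex0); rewrite eN_mul mulVf.
Qed.

Lemma e_sum (I : Type) (r : seq I) (P : pred I) (F : I -> R) :
  e (\sum_(i <- r | P i) F i) = \prod_(i <- r | P i) e (F i).
Proof. exact: (big_morph _ eD e0). Qed.

Lemma eMn x n : e (n%:R * x) = e x ^+ n.
Proof.
elim: n => [|n IH]; first by rewrite mul0r e0.
by rewrite exprS -IH -eD -{2}[x]mul1r -mulrDl -natr1 addrC.
Qed.

Lemma e_nat n : e (n%:R : R) = 1.
Proof.
have e1 : e (1 : R) = 1 by rewrite /e mulr1 mulr_natl cos2pi sin2pi.
by rewrite -[n%:R]mulr1 eMn e1 expr1n.
Qed.

Lemma e_int z : e (z%:~R : R) = 1.
Proof.
case: z => n; first exact: e_nat.
by rewrite NegzE mulrNz eN e_nat invr1.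
Qed.

(** For the fractional part [r], [cos (2 pi r) = 1] forces [sin (pi r) = 0], whereas the sine is
    positive on [(0, pi)]. *)
Lemma e_eq1 x : e x = 1 -> x \is a Num.int.
Proof.
move=> ex1; set z := Num.floor x; set r := x - z%:~R.
have er1 : e r = 1 by rewrite eD ex1 mul1r -mulrNz e_int.
have r_ge0 : 0 <= r by rewrite subr_ge0 floor_le.
have r_lt1 : r < 1 by rewrite ltrBlDl -intrD1 floorD1_gt.
suff r0 : r = 0 by rewrite intrEfloor -subr_eq0 -opprB oppr_eq0 -/r r0.
apply/eqP; rewrite eq_le r_ge0 andbT leNgt; apply/negP => r_gt0.
have pi_r : 0 < pi * r < pi by rewrite mulr_gt0 ?pi_gt0 //= gtr_pMr ?pi_gt0.
have := sin_gt0_pi pi_r; have : cos (pi * r *+ 2) = 1.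
  by rewrite -[pi * r]mul1r -mulrnAl mulrA; case: er1.
rewrite cos_mulr2n => c2; have s2 : sin (pi * r) ^+ 2 = 0 by rewrite sin2cos2; lra.
by move/eqP: s2; rewrite sqrf_eq0 => /eqP ->; rewrite ltxx.
Qed.

End Exponential.

Lemma scaler_mul3 (K : comNzRingType) (A : comAlgType K) (a b c : K) (x z w : A) :
  (a *: x) * (b *: z) * (c *: w) = (a * b * c) *: (x * z * w).
Proof. by rewrite -!scalerAl -!scalerAr -!scalerAl !scalerA; congr (_ *: _); ring. Qed.

Lemma prod_scale_mid (K : comNzRingType) (A : comAlgType K) p q
    (w : nat -> K) (f g : nat -> A) (h : A) :
  (\prod_(0 <= i < p + q.+1) w i) *:
    ((\prod_(0 <= i < p) f i) * h * \prod_(p.+1 <= i < p + q.+1) g i) =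
  (\prod_(0 <= i < p) (w i *: f i)) * (w p *: h) *
    \prod_(p.+1 <= i < p + q.+1) (w i *: g i).
Proof.
rewrite !scaler_prod scaler_mul3; congr (_ *: _).
rewrite (@big_cat_nat _ _ _ p) ?leq_addr //= -mulrA; congr (_ * _).
by rewrite big_ltn // addnS ltnS leq_addr.
Qed.

(** * Chains of integers in [(-M, M]] *)

Section BilateralChains.
Variables (R : realType) (m D M : nat) (phi : nat -> R) (y : nat -> mpoly m R[i]).

Let shifted (k : nat) : int := k%:Z - M%:Z.

(* Chains in [(-M, M]] are shifted to chains in [(0, 2 M]]: [k] stands for the
   summation index [k - M]. *)
Definition bilateral_factor i k : mpoly m R[i] :=
  e ((shifted k)%:~R * phi i) *: geo D (2 * shifted k - 1)%:~R (y i).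

Lemma geoN c (l : mpoly m R[i]) : geo D (- c) l = - geo D c (- l).
Proof.
rewrite /geo -sumrN; apply: eq_bigr => n _.
rewrite [(- c) ^+ _]exprNn [(- l) ^+ _]exprNn.
rewrite -[(-1) ^+ n.+1]signr_odd -[(-1) ^+ n]signr_odd /=.
by case: (odd n); rewrite /= ?expr0 ?expr1 ?mul1r ?mulN1r ?invrN ?scaleNr ?scalerN ?opprK.
Qed.

Lemma bilateral_factor_shift i k :
  bilateral_factor i (k + M) = e (k%:R * phi i) *: geo D (2 * k%:R - 1) (y i).
Proof.
rewrite /bilateral_factor (_ : shifted (k + M) = k%:Z); last by rewrite /shifted; lia.
by rewrite intrD intrM.
Qed.

(** The position [M + 1 - k] stands for the index [1 - k], whose denominator is [- (2 k - 1)]. Each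
    reflected factor thus yields a sign, a phase [e (phi i)] and the change of [y i] into
    [- y i]. *)
Lemma bilateral_factor_rev i k : (k <= M)%N ->
  bilateral_factor i (M.+1 - k) =
  (- e (phi i)) *: (e (- phi i) ^+ k *: geo D (2 * k%:R - 1) (- y i)).
Proof.
move=> kM; rewrite /bilateral_factor (_ : shifted _ = 1 - k%:Z); last by rewrite /shifted; lia.
rewrite (_ : (2 * (1 - k%:Z) - 1)%:~R = - (2 * k%:R - 1) :> R[i]); last first.
  by rewrite -[k%:R]/(k%:Z%:~R) !(intrD, intrM, intrN) mulr1z; ring.
have -> : (1 - k%:Z)%:~R * phi i = phi i + k%:R * - phi i.
  by rewrite intrD intrN mulr1z; ring.
by rewrite geoN scalerN scaleNr scalerA -eMn -eD.
Qed.

Lemma nat_subE k : (0 < k)%N -> (2 * k - 1)%N%:R = 2 * k%:R - 1 :> R[i].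
Proof. by move=> k0; rewrite natrB ?natrM // muln_gt0. Qed.

(** The cut at position [M] separates the indices [<= 0] from the positive ones; the part below the
    cut is reflected, and its [j] signs and phases give the coefficient. *)
Lemma bilateral_split n :
  chain_prod 0 (M + M) n bilateral_factor =
  \sum_(j < n.+1)
     ((-1) ^+ j * e (\sum_(0 <= i < j) phi i)) *:
     (chain_poly D (fun k => 2 * k - 1)%N (n - j)
         (fun i => e (phi (i + j)%N)) (fun i => y (i + j)) M *
      chain_poly D (fun k => 2 * k - 1)%N j
         (fun i => e (- phi (j - i.+1)%N)) (fun i => - y (j - i.+1)) M).
Proof.
rewrite (@chain_prod_cat _ 0 M) ?leq_addr //; apply: eq_bigr => j _.
set B := chain_poly _ _ (n - j) _ _ _; set A := chain_poly _ _ j _ _ _.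
have -> : chain_prod M (M + M) (n - j) (fun i => bilateral_factor (i + j)) = B.
  rewrite -{1}[M]add0n chain_prod_shift; apply: eq_chain_prod => i k _ /andP[k0 _].
  by rewrite bilateral_factor_shift eMn nat_subE.
rewrite [B * A]mulrC scalerAl.
suff -> : chain_prod 0 M j bilateral_factor =
  ((-1) ^+ j * e (\sum_(0 <= i < j) phi i)) *: A by [].
rewrite (@chain_prod_rev _ 0 M M) ?leqnn // subnn subn0.
transitivity (chain_prod 0 M j (fun i k => (- e (phi (j - i.+1)%N)) *:
   (e (- phi (j - i.+1)%N) ^+ k *: geo D (2 * k - 1)%N%:R (- y (j - i.+1))))).
  apply: eq_chain_prod => i k _ /andP[k0 kM].
  by rewrite (bilateral_factor_rev _ kM) nat_subE.
rewrite chain_prodZ; apply: (congr1 (fun x => x *: A)).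
rewrite e_sum [in RHS]big_nat_rev /= add0n !big_mkord.
by rewrite prodrN card_ord.
Qed.

Variables (n : nat) (y0 : forall i, mcoeff (@mnm0 m) (y i) = 0).

Let cc (k : nat) : R[i] := (2 * shifted k - 1)%:~R.
Let E i (k : nat) : R[i] := e ((shifted k)%:~R * phi i).
(** [L] and [S] invert [a_i - a_j] for [i < j] and [i > j] respectively. The sign in [L] makes the
    difference of the entries a positive natural number; it is the origin of the alternating sign on
    the right-hand side, as the factors [2^-1] are of its power of 2. *)
Let L j k0 i k : mpoly m R[i] :=
  - (2^-1 *: geo D (k0 - k)%N%:R (2^-1 *: (y j - y i))).
Let S j k0 i k : mpoly m R[i] :=
  2^-1 *: geo D (k - k0)%N%:R (2^-1 *: (y i - y j)).

Let piQ : {rmorphism mpoly m R[i] -> {ideal_quot (@high R[i] m D)}} :=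
  \pi_({ideal_quot (@high R[i] m D)})%qT.

(** Strict monotonicity of the chain makes all differences of entries nonzero, hence invertible in
    the quotient after subtracting a form without constant term. *)
Lemma bilateral_fractionsE s :
    size s = n.+1 -> path ltn 0 s ->
  piQ (\prod_(0 <= i < n.+1) geo D (cc (nth 0%N s i)) (y i)) =
  piQ (\sum_(0 <= j < n.+1)
    (\prod_(0 <= i < j) L j (nth 0%N s j) i (nth 0%N s i)) *
    geo D (cc (nth 0%N s j)) (y j) *
    \prod_(j.+1 <= i < n.+1) S j (nth 0%N s j) i (nth 0%N s i)).
Proof.
move=> sn s0; pose t i := nth 0%N s i.
have t_mono i j : (i < j < n.+1)%N -> (t i < t j)%N.
  move=> /andP[ij jn]; apply: (sorted_ltn_nth ltn_trans) => //.
  - by case: (s) s0 => //= x s' /andP[].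
  - by rewrite inE sn (ltn_trans ij).
  - by rewrite inE sn.
pose c i j := if (i < j)%N then L j (t j) i (t i) else S j (t j) i (t i).
have cE i j : (i < n.+1)%N -> (j < n.+1)%N -> i != j ->
    piQ (c i j) * (piQ ((cc (t i))%:A - y i) - piQ ((cc (t j))%:A - y j)) = 1.
  have yB0 i' j' : mcoeff (@mnm0 m) (2^-1 *: (y i' - y j')) = 0.
    by rewrite mcoeffZ mcoeffB !y0 subrr mulr0.
  have ccB i' j' : (t j' < t i')%N -> (t i' - t j')%N%:R = 2^-1 * (cc (t i') - cc (t j')) :> R[i].
    move=> tji; rewrite natrB 1?ltnW // /cc -intrB /shifted.
    rewrite (_ : _ - _ = 2 * ((t i')%:Z - (t j')%:Z)); last by ring.
    by rewrite intrM intrB mulrA mulVf ?mul1r // pnatr_eq0.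
  move=> lin ljn neq_ij; rewrite -rmorphB -rmorphM /=.
  have [lij|lij|/eqP] := ltngtP i j; last by rewrite (negPf neq_ij).
    rewrite -(@geoP R[i] m D (t j - t i)%N%:R (2^-1 *: (y j - y i))) //; last first.
      by rewrite pnatr_eq0 subn_eq0 -ltnNge t_mono // lij.
    apply: (congr1 piQ); rewrite /c lij /L ccB ?t_mono ?lij //.
    rewrite -scaleNr -scalerAl scalerAr; apply: (congr1 (fun x => _ * x)).
    rewrite scaleNr -scalerA -scalerBr -scalerN scalerBl.
    by apply: (congr1 (fun x => _ *: x)); ring.
  rewrite -(@geoP R[i] m D (t i - t j)%N%:R (2^-1 *: (y i - y j))) //; last first.
    by rewrite pnatr_eq0 subn_eq0 -ltnNge t_mono // lij.
  apply: (congr1 piQ); rewrite /c ltnNge ltnW //= /S ccB ?t_mono ?lij //.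
  rewrite -scalerAl scalerAr; apply: (congr1 (fun x => _ * x)).
  rewrite -scalerA -scalerBr scalerBl.
  by apply: (congr1 (fun x => _ *: x)); ring.
have bE i : (i < n.+1)%N -> piQ (geo D (cc (t i)) (y i)) * piQ ((cc (t i))%:A - y i) = 1.
  move=> _; rewrite -rmorphM; apply: geoP => //.
  (* An odd integer is nonzero. *)
  by rewrite /cc intr_eq0; lia.
rewrite rmorph_prod (partial_fractions (c := fun i j => piQ (c i j)) bE cE) rmorph_sum.
apply: eq_big_nat => j /= lj; rewrite !rmorphM !rmorph_prod.
have -> : \prod_(0 <= i < j) piQ (c i j) = \prod_(0 <= i < j) piQ (L j (t j) i (t i)).
  by apply: eq_big_nat => i /= lij; rewrite /c lij.
have -> : \prod_(j.+1 <= i < n.+1) piQ (c i j) =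
    \prod_(j.+1 <= i < n.+1) piQ (S j (t j) i (t i)).
  by apply: eq_big_nat => i /andP[lji _]; rewrite /c ltnNge (ltnW lji).
by [].
Qed.

Let EB i k d : (d <= k)%N -> E i (k - d) = E i k * e (- phi i) ^+ d.
Proof.
move=> dk; rewrite /E /shifted -eMn -eD -subzn //; apply: congr1.
by rewrite !intrB; ring.
Qed.

Let ED i k d : E i (k + d) = E i k * e (phi i) ^+ d.
Proof.
rewrite /E /shifted -eMn -eD PoszD; apply: congr1.
by rewrite !intrB intrD; ring.
Qed.

(** Reflection about the pivot turns the entries into the distances [k - k'], which run up to
    [k - 1] only. By [EB] the phase splits into that of the pivot, taken outside, and a power
    indexed by the distance. *)
Lemma left_chains j k : (0 < k)%N ->
  chain_prod 0 k.-1 j (fun i k' => E i k' *: L j k i k') =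
  (\prod_(0 <= i < j) (- (2^-1 * E i k))) *:
  chain_poly D id j (fun i => e (- phi (j - i.+1)%N))
    (fun i => 2^-1 *: (y j - y (j - i.+1)%N)) k.-1.
Proof.
move=> k0; rewrite (@chain_prod_rev _ 0 k.-1 k.-1) ?leqnn // subnn subn0.
rewrite big_nat_rev /= -chain_prodZ; apply: eq_chain_prod => i d _ /andP[d0 dk].
rewrite prednK // /L subKn; last by apply: leq_trans dk (leq_pred _).
rewrite scalerN -scaleNr !scalerA; apply: (congr1 (fun x => x *: _)).
rewrite add0n EB; last by apply: leq_trans dk (leq_pred _).
by set a := E _ _; set b := _ ^+ d; ring.
Qed.

Lemma right_chains j q k : (k <= M + M)%N ->
  chain_prod k (M + M) q (fun i k' => E (i + j.+1) k' *: S j k (i + j.+1) k') =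
  (\prod_(0 <= i < q) (2^-1 * E (i + j.+1) k)) *:
  chain_poly D id q (fun i => e (phi (i + j.+1)%N))
    (fun i => 2^-1 *: (y (i + j.+1)%N - y j)) (M + M - k).
Proof.
move=> kM; rewrite -{1}[k]add0n -{1}(subnK kM) chain_prod_shift -chain_prodZ.
apply: eq_chain_prod => i d _ _; rewrite /S addnK !scalerA.
apply: (congr1 (fun x => x *: _)); rewrite [(d + k)%N]addnC ED.
by set a := E _ _; set b := _ ^+ d; ring.
Qed.

(** The phases extracted at the pivot, one per index [i], combine into
    [e (k (phi_1 + ... + phi_m))]. Only coefficients up to degree [D] agree, the inverses being
    valid only in the quotient. *)
Lemma bilateral_fractions mu : (mdeg mu <= D)%N ->
  mcoeff mu (chain_prod 0 (M + M) n.+1 bilateral_factor) =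
  mcoeff mu ((2 ^+ n)^-1 *: \sum_(0 <= j < n.+1) (-1) ^+ j *:
    \sum_(1 <= k < (M + M).+1)
      chain_poly D id j (fun i => e (- phi (j - i.+1)%N))
          (fun i => 2^-1 *: (y j - y (j - i.+1)%N)) k.-1 *
      (e ((shifted k)%:~R * \sum_(0 <= i < n.+1) phi i) *:
        geo D (2 * shifted k - 1)%:~R (y j)) *
      chain_poly D id (n - j) (fun i => e (phi (i + j.+1)%N))
          (fun i => 2^-1 *: (y (i + j.+1)%N - y j)) (M + M - k)).
Proof.
move=> lmu; set lhs := chain_prod _ _ _ _; set rhs := _ *: _.
suff : piQ lhs = piQ rhs by move=> /high_eqP; apply.
pose P j s := (\prod_(0 <= i < j) L j (nth 0%N s j) i (nth 0%N s i)) *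
    geo D (cc (nth 0%N s j)) (y j) *
    \prod_(j.+1 <= i < n.+1) S j (nth 0%N s j) i (nth 0%N s i).
transitivity (piQ (chain_sum 0 (M + M) n.+1 (fun s =>
    (\prod_(0 <= i < n.+1) E i (nth 0%N s i)) *: \sum_(0 <= j < n.+1) P j s))).
  rewrite /lhs /chain_prod !chain_sum_raddf; apply: eq_chain_sum => s sn s0 _.
  rewrite scaler_prod -[_ *: \sum_(_ <= _ < _) _]mulr_algl -[X in piQ X = _]mulr_algl.
  apply: etrans (rmorphM piQ _ _) _; apply: etrans (esym (rmorphM piQ _ _)).
  exact: (congr1 (fun x => _ * x) (bilateral_fractionsE sn s0)).
apply: (congr1 piQ).
transitivity (chain_sum 0 (M + M) n.+1 (fun s => \sum_(0 <= j < n.+1)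
    (\prod_(0 <= i < n.+1) E i (nth 0%N s i)) *: P j s)).
  by apply: eq_chain_sum => s _ _ _; rewrite scaler_sumr.
rewrite chain_sum_sum /rhs scaler_sumr; apply: eq_big_nat => j /andP[_ lj].
have [q nE] : exists q, n = (j + q)%N by exists (n - j)%N; rewrite subnKC.
have nE1 : n.+1 = (j + q.+1)%N by rewrite nE addnS.
have qE : (n - j = q)%N by rewrite nE addKn.
transitivity (chain_sum 0 (M + M) (j + q.+1) (fun s =>
    (\prod_(0 <= i < j) (E i (nth 0%N s i) *: L j (nth 0%N s j) i (nth 0%N s i))) *
    (E j (nth 0%N s j) *: geo D (cc (nth 0%N s j)) (y j)) *
    \prod_(j.+1 <= i < j + q.+1)
      (E i (nth 0%N s i) *: S j (nth 0%N s j) i (nth 0%N s i)))).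
  rewrite -nE1; apply: eq_chain_sum => s _ _ _; rewrite /P nE1.
  exact: prod_scale_mid.
rewrite (chain_prod_mid 0 (M + M) j q (fun k i k' => E i k' *: L j k i k')
  (fun k i k' => E i k' *: S j k i k') (fun k => E j k *: geo D (cc k) (y j))).
rewrite !scaler_sumr; apply: eq_big_nat => k /andP[k0 kM].
rewrite (left_chains _ k0) (right_chains _ _ kM) qE.
set X := chain_poly _ _ _ _ _ _; set Y := chain_poly _ _ _ _ _ _; set G := geo _ _ _.
have XGY a : X * (a *: G) * Y = a *: (X * G * Y) by rewrite -scalerAr -scalerAl.
rewrite scaler_mul3 XGY !scalerA; apply: (congr1 (fun x => x *: _)).
have -> : e ((shifted k)%:~R * \sum_(0 <= i < n.+1) phi i) =
    \prod_(i < j) E i k * (E j k * \prod_(i < q) E (i + j.+1) k).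
  rewrite mulr_sumr e_sum nE1 (@big_cat_nat _ _ _ j) ?leq_addr //= big_mkord.
  congr (_ * _); rewrite big_ltn; last by rewrite addnS ltnS leq_addr.
  by rewrite -{1}[j.+1]add0n big_addn addnS subSS addKn big_mkord.
rewrite !big_mkord prodrN card_ord !big_split /= !prodr_const !card_ord.
rewrite nE exprD invfM -!exprVn.
set p1 := \prod_(i < j) _; set p2 := \prod_(i < q) _; set ej := E j k.
by ring.
Qed.

End BilateralChains.

(** * Rates of convergence *)

Import numFieldNormedType.Exports.

Section Modulus.
Variable R : realType.
Implicit Types z w : R[i].

(** The norm of [R[i]] takes values in [R[i]]; estimates by real arithmetic need the modulus in
    [R]. *)
Definition cmod z : R := Normc.normc z.

Lemma cmodE z : `|z| = (cmod z)%:C.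
Proof. by case: z => a b; rewrite normc_def. Qed.

Lemma cmod_ge0 z : 0 <= cmod z.
Proof. by case: z => a b; apply: sqrtr_ge0. Qed.

Lemma cmodM z w : cmod (z * w) = cmod z * cmod w.
Proof. exact: Normc.normcM. Qed.

Lemma cmodV z : cmod z^-1 = (cmod z)^-1.
Proof. exact: Normc.normcV. Qed.

Lemma cmodD z w : cmod (z + w) <= cmod z + cmod w.
Proof. exact: le_normcD. Qed.

Lemma cmod0 : cmod 0 = 0. Proof. exact: Normc.normc0. Qed.
Lemma cmod1 : cmod 1 = 1. Proof. exact: Normc.normc1. Qed.

Lemma cmodN z : cmod (- z) = cmod z.
Proof. exact: normcN. Qed.

Lemma cmodB z w : cmod (z - w) <= cmod z + cmod w.
Proof. by rewrite -[cmod w]cmodN; apply: cmodD. Qed.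

Lemma cmodX z n : cmod (z ^+ n) = cmod z ^+ n.
Proof. by elim: n => [|n IH]; rewrite ?cmod1 // !exprS cmodM IH. Qed.

Lemma cmod_real (x : R) : 0 <= x -> cmod x%:C = x.
Proof. by move=> x0; rewrite /cmod /= expr0n addr0 sqrtr_sqr ger0_norm. Qed.

Lemma cmod_nat n : cmod n%:R = n%:R.
Proof. by rewrite -(rmorph_nat (real_complex R)) cmod_real. Qed.

Lemma cmod_sum (I : eqType) (r : seq I) (P : pred I) (F : I -> R[i]) :
  cmod (\sum_(i <- r | P i) F i) <= \sum_(i <- r | P i) cmod (F i).
Proof.
apply: (big_rec2 (fun z x => cmod z <= x)); first by rewrite cmod0.
by move=> i z x _ lzx; apply: le_trans (cmodD _ _) _; rewrite lerD2l.
Qed.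

Lemma cmod_Re z : `|complex.Re z| <= cmod z.
Proof. by rewrite -lecR -cmodE normc_ge_Re. Qed.

Lemma cmod_Im z : `|complex.Im z| <= cmod z.
Proof.
case: z => a b; rewrite /cmod /= -sqrtr_sqr ler_sqrt ?addr_ge0 ?sqr_ge0 //.
by rewrite lerDr sqr_ge0.
Qed.

Lemma cmod_le z : cmod z <= `|complex.Re z| + `|complex.Im z|.
Proof.
case: z => a b /=; rewrite -[leRHS]ger0_norm ?addr_ge0 // -sqrtr_sqr.
rewrite /cmod /= ler_sqrt ?sqr_ge0 // sqrrD !real_normK ?num_real //.
by rewrite lerD2r lerDl mulrn_wge0 // mulr_ge0.
Qed.

Lemma cvg_cmod (u : nat -> (R[i] : numFieldType)) (L : R[i]) (b : R^nat) :
    (forall n, cmod (u n - L) <= b n) -> (b @ \oo --> (0 : R))%classic ->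
  (u @ \oo --> (L : (R[i] : numFieldType)))%classic.
Proof.
move=> ub b0; apply/cvgrPdist_le => eps eps0.
have epsE : eps = (cmod eps)%:C by rewrite -cmodE gtr0_norm.
have eps0' : 0 < cmod eps by rewrite -ltcR -epsE.
move/cvgrPdist_le : b0 => /(_ _ eps0'); apply: filterS => n.
rewrite sub0r normrN => bn; rewrite distrC cmodE epsE lecR.
by apply: le_trans (ub n) (le_trans (ler_norm _) bn).
Qed.

Lemma climit_eq (u : nat -> (R[i] : numFieldType)) (L : R[i]) :
  (u @ \oo --> (L : (R[i] : numFieldType)))%classic -> climit u = L.
Proof.
move=> uL; rewrite /climit.
exact: (cvg_lim (@norm_hausdorff (R[i] : numFieldType) (R[i] : numFieldType)) uL).
Qed.

End Modulus.

(** * Elementary estimates with inverse square roots *)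

Section InverseSqrt.
Variable R : realType.

Lemma sqrtr_ge1 (x : R) : 1 <= x -> 1 <= Num.sqrt x.
Proof. by move=> x1; rewrite -{1}sqrtr1 ler_sqrt // (le_trans ler01). Qed.

Definition isqrt (k : nat) : R := (Num.sqrt k%:R)^-1.

Lemma isqrt_gt0 k : (0 < k)%N -> 0 < isqrt k.
Proof. by move=> k0; rewrite invr_gt0 sqrtr_gt0 ltr0n. Qed.

Lemma isqrt_ge0 k : 0 <= isqrt k.
Proof. by rewrite invr_ge0 sqrtr_ge0. Qed.

Lemma isqrt_sqr k : isqrt k ^+ 2 = k%:R^-1.
Proof. by rewrite exprVn sqr_sqrtr. Qed.

Lemma isqrt_le k l : (0 < k <= l)%N -> isqrt l <= isqrt k.
Proof.
move=> /andP[k0 kl]; rewrite lef_pV2 ?posrE ?sqrtr_gt0 ?ltr0n //.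
  by rewrite ler_sqrt // ler_nat.
exact: leq_trans kl.
Qed.

Lemma sqrt_isqrt k : Num.sqrt k%:R = k%:R * isqrt k.
Proof.
case: k => [|k]; first by rewrite sqrtr0 mul0r.
by rewrite -{2}[k.+1%:R]sqr_sqrtr // expr2 mulfK // gt_eqF // sqrtr_gt0.
Qed.

(** With [a = k^(-1/2)] and [b = (k + 1)^(-1/2)]: [a^2 - b^2 = a^2 b^2] and [a^2 <= 2 b^2], so
    [a^4 <= 2 (a - b) (a + b) <= 4 a (a - b)]. *)
Lemma isqrt_cube k : (0 < k)%N -> isqrt k ^+ 3 <= 4 * (isqrt k - isqrt k.+1).
Proof.
move=> k0; have a0 := isqrt_gt0 k0; have b0 := isqrt_gt0 (ltn0Sn k).
have ba : isqrt k.+1 <= isqrt k by rewrite isqrt_le // k0 leqnSn.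
have k0' : 0 < k%:R :> R by rewrite ltr0n.
have abE : isqrt k ^+ 2 - isqrt k.+1 ^+ 2 = isqrt k ^+ 2 * isqrt k.+1 ^+ 2.
  rewrite !isqrt_sqr -natr1; field.
  by rewrite !gt_eqF //; lra.
have b2 : isqrt k ^+ 2 <= 2 * isqrt k.+1 ^+ 2.
  have : isqrt k ^+ 2 <= 1 by rewrite isqrt_sqr invf_le1 // ler1n.
  have := sqr_ge0 (isqrt k.+1); have := sqr_ge0 (isqrt k); nra.
rewrite -subr_ge0 -(pmulr_rge0 _ a0).
move: (isqrt k) (isqrt k.+1) a0 b0 ba abE b2 => a b *.
nra.
Qed.

Lemma sum_isqrt N : \sum_(1 <= k < N.+1) isqrt k <= 2 * Num.sqrt N%:R.
Proof.
elim: N => [|N IH]; first by rewrite big_geq // sqrtr0 mulr0.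
rewrite big_nat_recr //=; apply: le_trans (lerD IH (lexx _)) _.
rewrite /isqrt; set t := Num.sqrt N.+1%:R; set s := Num.sqrt N%:R.
have t0 : 0 < t by rewrite sqrtr_gt0.
have s0 : 0 <= s by rewrite sqrtr_ge0.
have tE : t ^+ 2 = s ^+ 2 + 1 by rewrite !sqr_sqrtr // -natr1.
rewrite -lerBrDl -(ler_pM2r t0) mulVf ?gt_eqF //; nra.
Qed.

Lemma isqrt_tail a b : (0 < a <= b)%N -> \sum_(a <= k < b) isqrt k ^+ 3 <= 4 * isqrt a.
Proof.
move=> /andP[a0 ab].
apply: (@le_trans _ _ (\sum_(a <= k < b) 4 * (isqrt k - isqrt k.+1))).
  by apply: ler_sum_nat => k /andP[ak _]; apply/isqrt_cube/(leq_trans a0).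
rewrite -mulr_sumr ler_pM2l //.
under eq_bigr => k _ do rewrite -opprB.
rewrite sumrN telescope_sumr // opprB gerBl; exact: isqrt_ge0.
Qed.

Lemma sqrt_cvg0 (f : R^nat) :
  (forall n, 0 <= f n) -> (f @ \oo --> (0 : R))%classic ->
  ((fun n => Num.sqrt (f n)) @ \oo --> (0 : R))%classic.
Proof.
move=> f0 /cvgrPdist_le fc; apply/cvgrPdist_le => eps eps0.
have eps2 : 0 < eps ^+ 2 by rewrite exprn_gt0.
move: (fc _ eps2); apply: filterS => n.
rewrite !sub0r !normrN !ger0_norm ?sqrtr_ge0 // => fn.
by rewrite -[leRHS]ger0_norm ?(ltW eps0) // -sqrtr_sqr ler_sqrt // ltW.
Qed.

Lemma isqrt_cvg : ((fun n => isqrt n.+1) @ \oo --> (0 : R))%classic.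
Proof.
have -> : (fun n => isqrt n.+1) = (fun n => Num.sqrt (@harmonic R n)).
  by apply: funext => n; rewrite /isqrt /= sqrtrV.
by apply: (@sqrt_cvg0 (@harmonic R)) cvg_harmonic => n; apply: harmonic_ge0.
Qed.

Lemma sqrt_isqrt_cvg : ((fun n => Num.sqrt (isqrt n.+1)) @ \oo --> (0 : R))%classic.
Proof. by apply: sqrt_cvg0 isqrt_cvg => n; exact: isqrt_ge0. Qed.

(* The fourth root comes from [1 / k <= 4 (k ^ (1/4) - (k - 1) ^ (1/4))]. *)
Lemma harmonic_le N :
  \sum_(1 <= k < N.+1) k%:R^-1 <= 4 * Num.sqrt (Num.sqrt N%:R) :> R.
Proof.
elim: N => [|N IH]; first by rewrite big_geq // !sqrtr0 mulr0.
rewrite big_nat_recr //=; apply: le_trans (lerD IH (lexx _)) _.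
set t := Num.sqrt (Num.sqrt N.+1%:R); set s := Num.sqrt (Num.sqrt N%:R).
have s0 : 0 <= s by rewrite sqrtr_ge0.
have t1 : 1 <= t by rewrite !sqrtr_ge1 // ler1n.
have tE : t ^+ 4 = N.+1%:R by rewrite (exprM _ 2 2) !sqr_sqrtr ?sqrtr_ge0.
have sE : s ^+ 4 = N%:R by rewrite (exprM _ 2 2) !sqr_sqrtr ?sqrtr_ge0.
rewrite -lerBrDl -tE -mulrBr.
have tsE : (t - s) * ((t + s) * (t ^+ 2 + s ^+ 2)) = 1.
  have -> : (t - s) * ((t + s) * (t ^+ 2 + s ^+ 2)) = t ^+ 4 - s ^+ 4 by ring.
  by rewrite tE sE -natr1 addrC addKr.
have X0 : 0 < (t + s) * (t ^+ 2 + s ^+ 2) by nra.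
have ts : 0 <= t - s by rewrite -(pmulr_lge0 _ X0) tsE.
have t2 : 1 <= t ^+ 2 by nra.
have X4 : (t + s) * (t ^+ 2 + s ^+ 2) <= 4 * t ^+ 4.
  have st2 : s ^+ 2 <= t ^+ 2 by nra.
  have : (t + s) * (t ^+ 2 + s ^+ 2) <= 4 * t ^+ 3.
    rewrite (_ : 4 * t ^+ 3 = (t + t) * (t ^+ 2 + t ^+ 2)); last by ring.
    by apply: ler_pM; rewrite ?addr_ge0 ?sqr_ge0 //; lra.
  have : t ^+ 3 <= t ^+ 4 by rewrite ler_weXn2l.
  lra.
have t40 : 0 < t ^+ 4 by rewrite exprn_gt0 //; lra.
rewrite -(ler_pM2r t40) mulVf ?gt_eqF //.
have := ler_wpM2l ts X4; rewrite tsE => /le_trans; apply.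
by rewrite mulrCA mulrA.
Qed.

(* Writing [l = N + 1 - k], [1 / (k sqrt l) = (sqrt l / k + 1 / sqrt l) / (N + 1)]. *)
Lemma convolution_le N :
  \sum_(1 <= k < N.+1) k%:R^-1 * isqrt (N.+1 - k) <= 6 * Num.sqrt (isqrt N.+1).
Proof.
set q := Num.sqrt (Num.sqrt N.+1%:R : R).
have q1 : 1 <= q by rewrite !sqrtr_ge1 // ler1n.
have q2 : Num.sqrt N.+1%:R = q ^+ 2 by rewrite sqr_sqrtr ?sqrtr_ge0.
have q4 : N.+1%:R = q ^+ 4 by rewrite (exprM _ 2 2) -q2 sqr_sqrtr.
have q0 : 0 < q by lra.
have -> : Num.sqrt (isqrt N.+1) = q^-1 by rewrite /isqrt sqrtrV ?sqrtr_ge0.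
apply: (@le_trans _ _ ((q ^+ 4)^-1 * (q ^+ 2 * (\sum_(1 <= k < N.+1) k%:R^-1) +
   \sum_(1 <= k < N.+1) isqrt (N.+1 - k)))).
  rewrite mulr_sumr -big_split mulr_sumr; apply: ler_sum_nat => k /andP[k0 kN].
  have l0 : (0 < N.+1 - k)%N by rewrite subn_gt0.
  have kl : k%:R + (N.+1 - k)%:R = q ^+ 4 by rewrite -natrD subnKC ?q4 // ltnW.
  have lq : (N.+1 - k)%:R * isqrt (N.+1 - k) <= q ^+ 2.
    by rewrite -sqrt_isqrt -q2 ler_sqrt // ler_nat leq_subr.
  have k0' : 0 < k%:R :> R by rewrite ltr0n.
  rewrite -(ler_pM2l (exprn_gt0 4 q0)) mulVKf ?gt_eqF ?exprn_gt0 // -kl.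
  rewrite (_ : _ * _ = (N.+1 - k)%:R * isqrt (N.+1 - k) / k%:R + isqrt (N.+1 - k)).
    by rewrite lerD2r ler_pM2r // invr_gt0.
  by field; rewrite gt_eqF.
have sE : \sum_(1 <= k < N.+1) isqrt (N.+1 - k) = \sum_(1 <= k < N.+1) isqrt k.
  by rewrite [RHS]big_nat_rev.
have q40 : 0 < q ^+ 4 by rewrite exprn_gt0.
have NN : N%:R <= N.+1%:R :> R by rewrite ler_nat.
have h1 : \sum_(1 <= k < N.+1) k%:R^-1 <= 4 * q.
  by apply: le_trans (harmonic_le N) _; rewrite ler_pM2l // !ler_sqrt ?sqrtr_ge0.
have h2 : \sum_(1 <= k < N.+1) isqrt (N.+1 - k) <= 2 * q ^+ 2.
  by rewrite sE; apply: le_trans (sum_isqrt N) _; rewrite ler_pM2l // -q2 ler_sqrt.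
rewrite mulrC ler_pdivrMr // (_ : 6 / q * q ^+ 4 = 6 * q ^+ 3); last by field; rewrite gt_eqF.
have q20 : 0 < q ^+ 2 by rewrite exprn_gt0.
have q3 : q ^+ 2 <= q ^+ 3 by rewrite ler_weXn2l.
have := ler_wpM2l (ltW q20) h1.
rewrite (_ : q ^+ 2 * (4 * q) = 4 * q ^+ 3); last by ring.
by move=> h3; lra.
Qed.

End InverseSqrt.

(** * Convergence with error [O(N^(-1/2))] *)

Section Rate.
Variable R : realType.
Implicit Types (u v : nat -> R[i]) (L : R[i]).

(** [N.+1] matters at [N = 0]: as [isqrt 0 = 0], a bound by [isqrt N] would force [u 0 = L]. *)
Definition has_rate u L :=
  exists c : R, forall N, cmod (u N - L) <= c * isqrt R N.+1.

Lemma isqrt_cvg0M (c : R) : ((fun n => c * isqrt R n.+1) @ \oo --> (0 : R))%classic.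
Proof.
by rewrite -(mulr0 c); apply: cvgM; [exact: cvg_cst|exact: isqrt_cvg].
Qed.

Lemma has_rate_cvg u L : has_rate u L ->
  ((u : nat -> (R[i] : numFieldType)) @ \oo --> (L : (R[i] : numFieldType)))%classic.
Proof. by case=> c uc; apply: cvg_cmod uc (isqrt_cvg0M c). Qed.

Lemma has_rate_cst L : has_rate (fun=> L) L.
Proof. by exists 0 => N; rewrite subrr cmod0 mul0r. Qed.

Lemma has_rateD u v L L' :
  has_rate u L -> has_rate v L' -> has_rate (fun N => u N + v N) (L + L').
Proof.
move=> [c uc] [c' vc]; exists (c + c') => N.
rewrite opprD addrACA mulrDl; apply: le_trans (cmodD _ _) _.
exact: lerD (uc N) (vc N).
Qed.

Lemma has_rateM (w : R[i]) u L : has_rate u L -> has_rate (fun N => w * u N) (w * L).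
Proof.
move=> [c uc]; exists (cmod w * c) => N; rewrite -mulrBr cmodM -mulrA.
exact: ler_wpM2l (cmod_ge0 w) _ _ (uc N).
Qed.

Lemma has_rate_sum (I : Type) (r : seq I) (P : pred I) (u : I -> nat -> R[i]) (L : I -> R[i]) :
    (forall i, P i -> has_rate (u i) (L i)) ->
  has_rate (fun N => \sum_(i <- r | P i) u i N) (\sum_(i <- r | P i) L i).
Proof.
move=> uL; elim: r => [|i r IH].
  by rewrite big_nil; exists 0 => N; rewrite big_nil subrr cmod0 mul0r.
rewrite big_cons; case: ifP => Pi; last first.
  by case: IH => c h; exists c => N; rewrite big_cons Pi.
by case: (has_rateD (uL i Pi) IH) => c h; exists c => N; rewrite big_cons Pi.
Qed.

Lemma real_cauchy_rate (v : R^nat) (c : R) :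
    (forall N N', (N <= N')%N -> `|v N' - v N| <= c * isqrt R N.+1) ->
  exists l, forall N, `|v N - l| <= c * isqrt R N.+1.
Proof.
move=> vc.
have vcvg : cvg (v @ \oo)%classic.
  apply/cauchy_cvgP; apply: cauchy_exP => eps eps0.
  have /cvgrPdist_lt/(_ _ eps0)[N _ hN] := isqrt_cvg0M c.
  exists (v N); exists N => // n /= Nn; rewrite /ball /= distrC.
  apply: le_lt_trans (vc _ _ Nn) _; apply: le_lt_trans (ler_norm _) _.
  by have := hN N (leqnn N); rewrite sub0r normrN.
exists (lim (v @ \oo)%classic) => N; apply/ler_addgt0Pr => eps eps0.
have /cvgrPdist_le/(_ _ eps0)[n _ hn] := vcvg.
have := hn (maxn n N) (leq_maxl _ _).
have := vc N (maxn n N) (leq_maxr _ _).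
rewrite !ler_norml; lra.
Qed.

Lemma cauchy_rate u (c : R) :
    (forall N N', (N <= N')%N -> cmod (u N' - u N) <= c * isqrt R N.+1) ->
  exists L, has_rate u L.
Proof.
move=> uc.
have [|l1 h1] := @real_cauchy_rate (fun N => complex.Re (u N)) c.
  by move=> N N' /uc; apply: le_trans; rewrite -raddfB; exact: cmod_Re.
have [|l2 h2] := @real_cauchy_rate (fun N => complex.Im (u N)) c.
  by move=> N N' /uc; apply: le_trans; rewrite -raddfB; exact: cmod_Im.
exists (l1 +i* l2); exists (c + c) => N; apply: le_trans (cmod_le _) _.
rewrite mulrDl; apply: le_trans (lerD (h1 N) (h2 N)).
by case: (u N).
Qed.

(** Multiplied by [q - 1], a block of the sum becomes two boundary terms, at most
    [2 a isqrt (N + 1)] together, minus a sum of increments of [g], at most [4 a isqrt (N + 1)] by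
    [isqrt_tail]; hence the constant 6. *)
Lemma abel_rate (q : R[i]) (g : nat -> R[i]) (a : R) :
    cmod q = 1 -> q != 1 ->
    (forall k, (0 < k)%N -> cmod (g k) <= a * isqrt R k) ->
    (forall k, (0 < k)%N -> cmod (g k.+1 - g k) <= a * isqrt R k ^+ 3) ->
  exists L, has_rate (fun N => \sum_(1 <= k < N.+1) q ^+ k * g k) L.
Proof.
move=> q1 q_neq1 ga gda.
have a0 : 0 <= a.
  have := le_trans (cmod_ge0 _) (ga 1%N isT).
  by rewrite pmulr_lge0 // isqrt_gt0.
have cq0 : 0 < cmod (q - 1).
  rewrite lt_def cmod_ge0 andbT; apply: contra q_neq1 => /eqP/Normc.eq0_normc/eqP.
  by rewrite subr_eq0.
apply: (@cauchy_rate _ (6 * a / cmod (q - 1))) => N N' NN'.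
rewrite (@big_cat_nat _ _ _ N.+1 1 N'.+1) //= addrAC subrr add0r.
rewrite mulrAC ler_pdivlMr // mulrC -cmodM mulr_sumr.
have -> : \sum_(N.+1 <= k < N'.+1) (q - 1) * (q ^+ k * g k) =
    (q ^+ N'.+1 * g N'.+1 - q ^+ N.+1 * g N.+1) -
    \sum_(N.+1 <= k < N'.+1) q ^+ k.+1 * (g k.+1 - g k).
  rewrite -(telescope_sumr (fun k => q ^+ k * g k)) // -sumrB.
  by apply: eq_bigr => k _; rewrite exprS; ring.
have qk k : cmod (q ^+ k) = 1 by rewrite cmodX q1 expr1n.
apply: le_trans (cmodB _ _) _.
have h1 : cmod (q ^+ N'.+1 * g N'.+1 - q ^+ N.+1 * g N.+1) <= 2 * a * isqrt R N.+1.
  apply: le_trans (cmodB _ _) _; rewrite !cmodM !qk !mul1r.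
  have := ga N.+1 isT; have := ga N'.+1 isT.
  have : a * isqrt R N'.+1 <= a * isqrt R N.+1 by rewrite ler_wpM2l // isqrt_le.
  lra.
have h2 : cmod (\sum_(N.+1 <= k < N'.+1) q ^+ k.+1 * (g k.+1 - g k)) <=
    4 * a * isqrt R N.+1.
  apply: le_trans (cmod_sum _ _ _) _.
  apply: (@le_trans _ _ (\sum_(N.+1 <= k < N'.+1) a * isqrt R k ^+ 3)).
    apply: ler_sum_nat => k /andP[Nk _]; rewrite cmodM qk mul1r.
    by apply: gda; apply: leq_trans Nk.
  rewrite -mulr_sumr [4 * a]mulrC -mulrA ler_wpM2l //; apply: isqrt_tail.
  by rewrite /= ltnS.
lra.
Qed.

(** Each nesting level sums [sqrt k / k = 1 / sqrt k], which costs a factor 2 and returns to the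
    same order of growth; [N.+1] covers the empty chain. *)
Lemma chain_prod_bound n (T : nat -> nat -> R[i]) N :
    (forall i k, (i < n)%N -> (0 < k)%N -> cmod (T i k) <= k%:R^-1) ->
  cmod (chain_prod 0 N n T) <= 2 ^+ n * Num.sqrt N.+1%:R.
Proof.
elim: n N => [|n IH] N Tn.
  rewrite /chain_prod /= big_geq // cmod1 mul1r sqrtr_ge1 //.
  by rewrite ler1n.
rewrite chain_prod_recr; apply: le_trans (cmod_sum _ _ _) _.
apply: (@le_trans _ _ (\sum_(1 <= k < N.+1) 2 ^+ n * isqrt R k)).
  apply: ler_sum_nat => k /andP[k0 _]; rewrite cmodM.
  have h1 : cmod (chain_prod 0 k.-1 n T) <= 2 ^+ n * Num.sqrt k%:R.
    by rewrite -{2}(prednK k0); apply: IH => i l /leqW; apply: Tn.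
  apply: le_trans (ler_pM (cmod_ge0 _) (cmod_ge0 _) h1 (Tn n k (leqnn _) k0)) _.
  rewrite sqrt_isqrt -mulrA ler_pM2l ?exprn_gt0 // mulrAC mulfV ?mul1r //.
  by rewrite pnatr_eq0 -lt0n.
rewrite -mulr_sumr exprS [2 * _]mulrC -mulrA ler_pM2l ?exprn_gt0 //.
apply: le_trans (sum_isqrt _ _) _.
by rewrite ler_pM2l // ler_sqrt // ler_nat.
Qed.

(** Only chains ending at [N + 1] are new, so the bound [sqrt (N + 1)] gets divided by [N + 1]. *)
Lemma chain_prod_increment n (T : nat -> nat -> R[i]) N :
    (forall i k, (i < n)%N -> (0 < k)%N -> cmod (T i k) <= k%:R^-1) ->
  cmod (chain_prod 0 N.+1 n T - chain_prod 0 N n T) <= 2 ^+ n * isqrt R N.+1.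
Proof.
case: n => [|n] Tn.
  by rewrite /chain_prod /= subrr cmod0 mulr_ge0 ?isqrt_ge0.
rewrite !chain_prod_recr big_nat_recr //= addrAC subrr add0r cmodM.
have h1 : cmod (chain_prod 0 N n T) <= 2 ^+ n * Num.sqrt N.+1%:R.
  by apply: chain_prod_bound => i k /leqW; apply: Tn.
apply: le_trans (ler_pM (cmod_ge0 _) (cmod_ge0 _) h1 (Tn n N.+1 (leqnn _) isT)) _.
rewrite sqrt_isqrt -mulrA mulrAC mulfV ?mul1r ?pnatr_eq0 //.
rewrite exprS -mulrA ler_peMl ?ler1n // mulr_ge0 ?isqrt_ge0 ?exprn_ge0 //.
Qed.

Lemma exprB_le (x y : R) p : 0 <= y <= x -> x <= 1 -> x ^+ p - y ^+ p <= p%:R * (x - y).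
Proof.
move=> /andP[y0 yx] x1; elim: p => [|p IH]; first by rewrite subrr mul0r.
rewrite (_ : _ - _ = x * (x ^+ p - y ^+ p) + (x - y) * y ^+ p); last by rewrite !exprS; ring.
have x0 : 0 <= x by lra.
have yp : y ^+ p <= 1 by rewrite exprn_ile1 //; lra.
have yp0 : 0 <= y ^+ p by rewrite exprn_ge0.
have xyp : 0 <= x ^+ p - y ^+ p by rewrite subr_ge0 lerXn2r.
rewrite (_ : p.+1%:R * _ = p%:R * (x - y) + (x - y)); last by rewrite -natr1; ring.
apply: lerD.
  by apply: le_trans IH; rewrite ler_piMl.
by rewrite ler_piMr // subr_ge0.
Qed.

Lemma nested_term_increment (S0 S1 w0 w1 : R[i]) :
  S1 * w1 - S0 * w0 = (S1 - S0) * w1 - S0 * (w0 - w1).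
Proof. by ring. Qed.

Section Denominators.
Variable d : nat -> nat.
(** The common properties of the denominators [k] and [2 k - 1]. *)
Hypothesis d_ge : forall k, (k <= d k)%N.
Hypothesis d_step : forall k, (0 < k)%N -> (d k <= d k.+1 <= d k + 2)%N.

Lemma cmod_term (q : R[i]) p k : cmod q = 1 -> (0 < p)%N -> (0 < k)%N ->
  cmod (q ^+ k / (d k)%:R ^+ p) <= k%:R^-1.
Proof.
move=> q1 p0 k0; rewrite cmodM cmodX q1 expr1n mul1r cmodV cmodX cmod_nat.
have dk0 : (0 < d k)%N by apply: leq_trans (d_ge k).
rewrite lef_pV2 ?posrE ?exprn_gt0 ?ltr0n // -natrX ler_nat.
by apply: leq_trans (d_ge k) _; rewrite -{1}[d k]expn1 leq_pexp2l.
Qed.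

Lemma denominator_step p k : (0 < k)%N ->
  cmod ((d k)%:R ^- p - (d k.+1)%:R ^- p) <= (2 * p)%N%:R * isqrt R k ^+ 4.
Proof.
move=> k0; have /andP[dd dd2] := d_step k0.
have dk0 : (0 < d k)%N by apply: leq_trans (d_ge k).
have dk1 : (0 < d k.+1)%N by apply: leq_trans dd.
pose x : R := (d k)%:R^-1; pose y : R := (d k.+1)%:R^-1.
have xk : x <= k%:R^-1 by rewrite lef_pV2 ?posrE ?ltr0n // ler_nat.
have x0 : 0 < x by rewrite invr_gt0 ltr0n.
have y0 : 0 < y by rewrite invr_gt0 ltr0n.
have yx : y <= x by rewrite lef_pV2 ?posrE ?ltr0n // ler_nat.
have x1 : x <= 1 by rewrite invf_le1 ?ltr0n // ler1n.
have -> : (d k)%:R ^- p - (d k.+1)%:R ^- p = (x ^+ p - y ^+ p)%:C.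
  by rewrite rmorphB !rmorphXn !fmorphV !rmorph_nat !exprVn.
have xyp : 0 <= x ^+ p - y ^+ p by rewrite subr_ge0 lerXn2r // ?nnegrE ltW.
rewrite cmod_real //; apply: le_trans (exprB_le _ _ x1) _; first by rewrite (ltW y0).
rewrite mulnC natrM -mulrA ler_wpM2l //.
have -> : x - y = ((d k.+1)%:R - (d k)%:R) * (x * y).
  by rewrite /x /y; field; rewrite !pnatr_eq0 -!lt0n dk0 dk1.
have h : (d k.+1)%:R - (d k)%:R <= 2 :> R by rewrite lerBlDl -natrD ler_nat.
apply: ler_pM => //.
- by rewrite subr_ge0 ler_nat.
- by rewrite mulr_ge0 // ltW.
rewrite (exprM _ 2 2) isqrt_sqr expr2; apply: ler_pM => //; [exact: ltW|exact: ltW|].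
exact: le_trans yx xk.
Qed.

(** Abel summation over the last entry alone: the inner chains, whatever their [eps], are absorbed
    into the slowly varying [g]. *)
Lemma chain_rate n (eps : nat -> R[i]) (p : nat -> nat) :
    (forall i, cmod (eps i) = 1) -> (forall i, (0 < p i)%N) ->
    (0 < n)%N -> eps n.-1 != 1 ->
  exists L, has_rate (fun N =>
    chain_prod 0 N n (fun i k => eps i ^+ k / (d k)%:R ^+ p i)) L.
Proof.
case: n => // n e1 p0 _ en.
pose T i k : R[i] := eps i ^+ k / (d k)%:R ^+ p i.
have Tb i k : (0 < k)%N -> cmod (T i k) <= k%:R^-1 by move=> k0; apply: cmod_term.
pose g k := chain_prod 0 k.-1 n T / (d k)%:R ^+ p n.
(* The increment of [g] has two parts: the inner sum changes, which gives [2 ^ n], and the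
   denominator changes, which gives [2 ^ n * 2 p]. *)
have [k k0|k k0|L [c hc]] := @abel_rate (eps n) g (2 ^+ n * (1 + 2 * (p n)%:R)) (e1 n) en.
- have h1 : cmod (chain_prod 0 k.-1 n T) <= 2 ^+ n * Num.sqrt k%:R.
    by rewrite -{2}(prednK k0); apply: chain_prod_bound => i l _; apply: Tb.
  have dk : cmod ((d k)%:R ^- p n) <= k%:R^-1 :> R.
    by have := cmod_term (q := 1) (cmod1 R) (p0 n) k0; rewrite expr1n mul1r.
  rewrite /g cmodM.
  apply: le_trans (ler_pM (cmod_ge0 _) (cmod_ge0 _) h1 dk) _.
  have kn0 : k%:R != 0 :> R by rewrite pnatr_eq0 -lt0n.
  rewrite (_ : 2 ^+ n * Num.sqrt k%:R * k%:R^-1 = 2 ^+ n * isqrt R k); last first.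
    by rewrite sqrt_isqrt; field.
  by rewrite ler_wpM2r ?isqrt_ge0 // ler_peMr ?exprn_ge0 // lerDl mulr_ge0.
- have h1 : cmod (chain_prod 0 k.-1 n T) <= 2 ^+ n * Num.sqrt k%:R.
    by rewrite -{2}(prednK k0); apply: chain_prod_bound => i l _; apply: Tb.
  have h2 : cmod (chain_prod 0 k n T - chain_prod 0 k.-1 n T) <= 2 ^+ n * isqrt R k.
    by rewrite -{1 3}(prednK k0); apply: chain_prod_increment => i l _; apply: Tb.
  have h3 : cmod ((d k.+1)%:R ^- p n) <= isqrt R k ^+ 2.
    rewrite isqrt_sqr; have := cmod_term (q := 1) (cmod1 R) (p0 n) (ltn0Sn k).
    rewrite expr1n mul1r => /le_trans; apply.
    by rewrite lef_pV2 ?posrE ?ltr0n // ler_nat.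
  rewrite /g /= nested_term_increment; apply: le_trans (cmodB _ _) _.
  rewrite !cmodM mulrDr mulr1 mulrDl; apply: lerD.
    apply: le_trans (ler_pM (cmod_ge0 _) (cmod_ge0 _) h2 h3) _.
    by rewrite -mulrA -exprS.
  have h4 := denominator_step (p n) k0.
  apply: le_trans (ler_pM (cmod_ge0 _) (cmod_ge0 _) h1 h4) _.
  rewrite (_ : _ * Num.sqrt _ * _ = 2 ^+ n * (2 * (p n)%:R) *
     isqrt R k ^+ 3 * (k%:R * isqrt R k ^+ 2)).
    by rewrite isqrt_sqr mulfV ?mulr1 // pnatr_eq0 -lt0n.
  by rewrite sqrt_isqrt natrM; ring.
exists L; exists c => N; rewrite chain_prod_recr.
under eq_big_nat => k _ do rewrite mulrCA.
exact: hc.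
Qed.

End Denominators.
End Rate.

(** * Passage to the limit *)

(** Pairs the indices [1 - k] and [k], whose denominators are [-(2 k - 1)] and [2 k - 1]: on both
    halves the weight is [O(1 / k)]. *)
Lemma sum_center (V : nmodType) M (F : nat -> V) :
  \sum_(1 <= k < (M + M).+1) F k =
  \sum_(1 <= k < M.+1) F (M.+1 - k)%N + \sum_(1 <= k < M.+1) F (k + M)%N.
Proof.
rewrite (@big_cat_nat _ _ _ M.+1) ?ltnS ?leq_addr //= big_nat_rev /=; congr (_ + _).
by rewrite -{1}[M.+1]add1n big_addn -addSn addnK.
Qed.

Section Limits.
Variable R : realType.
Local Notation C := (R[i] : numFieldType).

Lemma cvg_bigsum (I : Type) (r : seq I) (P : pred I) (u : I -> nat -> C) (L : I -> C) :
    (forall i, P i -> (u i @ \oo --> L i)%classic) ->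
  ((fun N => \sum_(i <- r | P i) u i N) @ \oo --> \sum_(i <- r | P i) L i)%classic.
Proof.
move=> uL; elim: r => [|i r IH].
  rewrite big_nil (_ : (fun N => _) = fun=> 0); first exact: cvg_cst.
  by apply: funext => N; rewrite big_nil.
rewrite big_cons; case: ifP => Pi.
  rewrite (_ : (fun N => _) = fun N => u i N + \sum_(j <- r | P j) u j N).
    exact: (cvgD (uL i Pi) IH).
  by apply: funext => N; rewrite big_cons Pi.
rewrite (_ : (fun N => _) = fun N => \sum_(j <- r | P j) u j N) //.
by apply: funext => N; rewrite big_cons Pi.
Qed.

Lemma isqrt_le1 N : isqrt R N.+1 <= 1.
Proof. by rewrite invf_le1 ?sqrtr_gt0 ?ltr0n // sqrtr_ge1 // ler1n. Qed.

Lemma has_rate_pos (u : nat -> R[i]) L : has_rate u L ->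
  exists2 c, 0 <= c & forall N, cmod (u N - L) <= c * isqrt R N.+1.
Proof.
move=> [c uc]; exists c => //; have := le_trans (cmod_ge0 _) (uc 0%N).
by rewrite pmulr_lge0 // isqrt_gt0.
Qed.

(** The main term [a * b] times the sum of the [c M k] converges by assumption; the remainder is
    controlled by [convolution_le], where the rates of [u] and [v] beat the divergence of the sum of
    [1 / k]. *)
Lemma convolution_cvg (c : nat -> nat -> R[i]) (u v : nat -> R[i]) (a b s : R[i]) (K : R) :
    has_rate u a -> has_rate v b ->
    (forall M k, (0 < k <= M)%N -> cmod (c M (M.+1 - k)%N) <= K * k%:R^-1) ->
    (forall M k, (0 < k <= M)%N -> cmod (c M (k + M)%N) <= K * k%:R^-1) ->
    ((fun M => \sum_(1 <= k < (M + M).+1) c M k : C) @ \oo --> (s : C))%classic ->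
  ((fun M => \sum_(1 <= k < (M + M).+1) u k.-1 * c M k * v (M + M - k)%N : C)
    @ \oo --> (a * s * b : C))%classic.
Proof.
move=> /has_rate_pos[cu cu0 uc] /has_rate_pos[cv cv0 vc] cl cr cs.
have K0 : 0 <= K by have := le_trans (cmod_ge0 _) (cl 1%N 1%N isT); rewrite invr1 mulr1.
pose Q := cu * (cv + cmod b) + cmod a * cv.
have Q0 : 0 <= Q by rewrite addr_ge0 ?mulr_ge0 ?addr_ge0 ?cmod_ge0.
have uv M k : (0 < k < (M + M).+1)%N ->
    cmod (u k.-1 * v (M + M - k)%N - a * b) <= Q * (isqrt R k + isqrt R ((M + M).+1 - k)).
  move=> /andP[k0 kM]; rewrite subSn //.
  have := uc k.-1; rewrite prednK // => hu; have hv := vc (M + M - k)%N.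
  rewrite (_ : _ - _ = (u k.-1 - a) * v (M + M - k)%N + a * (v (M + M - k)%N - b)); last by ring.
  apply: le_trans (cmodD _ _) _; rewrite !cmodM.
  have vb : cmod (v (M + M - k)%N) <= cv + cmod b.
    rewrite -[v _](subrK b); apply: le_trans (cmodD _ _) _; rewrite lerD2r.
    by apply: le_trans hv _; rewrite ler_piMr // isqrt_le1.
  have h1 := ler_pM (cmod_ge0 _) (cmod_ge0 _) hu vb.
  have h2 := ler_wpM2l (cmod_ge0 a) hv.
  apply: le_trans (lerD h1 h2) _.
  have i1 := isqrt_ge0 R k; have i2 := isqrt_ge0 R (M + M - k).+1.
  have p1 : 0 <= cu * (cv + cmod b) * isqrt R (M + M - k).+1.
    by rewrite !mulr_ge0 // addr_ge0 // cmod_ge0.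
  have p2 : 0 <= cmod a * cv * isqrt R k by rewrite !mulr_ge0 // cmod_ge0.
  by rewrite -subr_ge0 (_ : _ - _ = cu * (cv + cmod b) * isqrt R (M + M - k).+1 +
    cmod a * cv * isqrt R k) ?addr_ge0 // /Q; ring.
pose W M := \sum_(1 <= k < M.+1) k%:R^-1 * isqrt R (M.+1 - k).
pose rem M := \sum_(1 <= k < (M + M).+1) c M k * (u k.-1 * v (M + M - k)%N - a * b).
(* [24 = 2 * 2 * 6]: two truncation errors, two halves of the range, and the constant of
   [convolution_le]. *)
have remW M : cmod (rem M) <= 24 * K * Q * Num.sqrt (isqrt R M.+1).
  apply: le_trans (cmod_sum _ _ _) _.
  rewrite sum_center; have hW : W M <= 6 * Num.sqrt (isqrt R M.+1) by exact: convolution_le.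
  have h (k l : nat) : (0 < k <= M)%N -> (l = M.+1 - k \/ l = k + M)%N ->
      cmod (c M l * (u l.-1 * v (M + M - l)%N - a * b)) <=
      2 * K * Q * (k%:R^-1 * isqrt R (M.+1 - k)).
    move=> k0M lk; have lM : (0 < l < (M + M).+1)%N by lia.
    have cK : cmod (c M l) <= K * k%:R^-1 by case: lk => ->; [apply: cl|apply: cr].
    (* At distance [k] from the centre, both ranges of differences still have length at least about
       [M - k]. *)
    have i1 : isqrt R l <= isqrt R (M.+1 - k) by apply: isqrt_le; lia.
    have i2 : isqrt R ((M + M).+1 - l) <= isqrt R (M.+1 - k) by apply: isqrt_le; lia.
    rewrite cmodM; apply: le_trans (ler_pM (cmod_ge0 _) (cmod_ge0 _) cK (uv M l lM)) _.
    rewrite (_ : 2 * K * Q * _ = K * k%:R^-1 * (Q * (2 * isqrt R (M.+1 - k)))); last by ring.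
    rewrite ler_wpM2l ?mulr_ge0 ?invr_ge0 // ler_wpM2l //; lra.
  have hs (F : nat -> nat) : (forall k, F k = M.+1 - k \/ F k = k + M)%N ->
      \sum_(1 <= k < M.+1) cmod (c M (F k) * (u (F k).-1 * v (M + M - F k)%N - a * b))
      <= 2 * K * Q * W M.
    move=> Fk; rewrite mulr_sumr; apply: ler_sum_nat => k /andP[k0 kM].
    by apply: h; rewrite ?k0.
  have := hs (fun k => M.+1 - k)%N (fun k => or_introl erefl).
  have := hs (fun k => k + M)%N (fun k => or_intror erefl).
  have := ler_wpM2l (mulr_ge0 (mulr_ge0 (ler0n R 2) K0) Q0) hW; lra.
have rem0 : ((rem : nat -> C) @ \oo --> (0 : C))%classic.
  apply: (@cvg_cmod _ _ _ (fun M => 24 * K * Q * Num.sqrt (isqrt R M.+1))).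
    by move=> M; rewrite subr0; apply: remW.
  by rewrite -(mulr0 (24 * K * Q)); apply: cvgM; [exact: cvg_cst|exact: sqrt_isqrt_cvg].
have -> : (fun M => \sum_(1 <= k < (M + M).+1) u k.-1 * c M k * v (M + M - k)%N : C) =
    (fun M => (a * \sum_(1 <= k < (M + M).+1) c M k) * b + rem M : C).
  apply: funext => M; rewrite mulr_sumr mulr_suml -big_split /=.
  by apply: eq_bigr => k _; ring.
rewrite -[a * s * b]addr0.
exact: (cvgD (cvgM (cvgM (cvg_cst (a : C)) cs) (cvg_cst (b : C))) rem0).
Qed.

End Limits.

(** * Rates for the coefficients of [Li], [Lit] and [Bt] *)

Section SeriesLimits.
Variable R : realType.
Local Notation C := (R[i] : numFieldType).

Lemma has_rate_ext (u v : nat -> R[i]) L : u =1 v -> has_rate u L -> has_rate v L.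
Proof. by move=> uv [c h]; exists c => N; rewrite -uv. Qed.

Lemma has_rate_climit (u : nat -> C) L : has_rate u L -> climit u = L.
Proof. by move=> /has_rate_cvg/climit_eq. Qed.

Lemma cmod_e (x : R) : cmod (e x) = 1.
Proof. by rewrite /cmod /e /= cos2Dsin2 sqrtr1. Qed.

Lemma nested_sum_chain (d : nat -> nat) k (eps : nat -> R[i]) (p : nat -> nat) N :
  nested_sum d (fun i : 'I_k => eps i) (fun i : 'I_k => p i) N =
  chain_prod 0 N k (fun i j => eps i ^+ j / (d j)%:R ^+ p i).
Proof.
rewrite /chain_prod -chain_sum_tuple; apply: eq_bigr => t _.
rewrite big_mkord; apply: eq_bigr => i _.
have -> : nth 0%N (map val t) i = tnth t i; last by [].
by rewrite (nth_map ord0) ?size_tuple // (tnth_nth ord0).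
Qed.

Lemma nested_sum_rate (d : nat -> nat) (ph : seq R) (nu : multinom (size ph)) :
    (forall k, (k <= d k)%N) ->
    (forall k, (0 < k)%N -> (d k <= d k.+1 <= d k + 2)%N) ->
    ((0 < size ph)%N -> e ph`_(size ph).-1 != 1) ->
  has_rate
    (nested_sum d (fun i : 'I_(size ph) => e ph`_i) (fun i => (nu i).+1))
    (climit (nested_sum d (fun i : 'I_(size ph) => e ph`_i) (fun i => (nu i).+1))).
Proof.
move=> d_ge d_step elast.
have [p p0 nE] : exists2 p : nat -> nat, (forall i, 0 < p i)%N &
    (fun i => (nu i).+1) = (fun i : 'I_(size ph) => p i).
  exists (fun i => (nth 0%N nu i).+1) => //.
  by apply: funext => i; rewrite (mnm_nth 0%N).
have [L hL] : exists L, has_rate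
    (nested_sum d (fun i : 'I_(size ph) => e ph`_i) (fun i => (nu i).+1)) L.
  rewrite nE; case: (posnP (size ph)) => [s0|s0].
    exists 1; apply: has_rate_ext (@has_rate_cst R 1) => N.
    by rewrite (@nested_sum_chain d (size ph) (fun i => e ph`_i) p) s0
      /chain_prod /= big_geq.
  have [L hL] := chain_rate d_ge d_step (eps := fun i => e ph`_i)
    (p := p) (fun i => cmod_e _) p0 s0 (elast s0).
  exists L; apply: has_rate_ext hL => N.
  by rewrite (@nested_sum_chain d (size ph) (fun i => e ph`_i) p).
by rewrite (has_rate_climit hL).
Qed.

Lemma nested_fps_rate (m D : nat) (d : nat -> nat) (ph : seq R)
    (l : seq (mpoly m R[i])) (mu : multinom m) :
    (forall k, (k <= d k)%N) ->
    (forall k, (0 < k)%N -> (d k <= d k.+1 <= d k + 2)%N) ->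
    ((0 < size ph)%N -> e ph`_(size ph).-1 != 1) ->
    (forall i, mcoeff (@mnm0 m) l`_i = 0) -> (mdeg mu <= D)%N ->
  has_rate
    (fun N => mcoeff mu (chain_poly D d (size ph) (fun i => e ph`_i) (fun i => l`_i) N))
    (fps_subst (fun nu : multinom (size ph) => climit
       (nested_sum d (fun i : 'I_(size ph) => e ph`_i) (fun i => (nu i).+1)))
       (fun i => l`_i) mu).
Proof.
move=> d_ge d_step elast l0 lD.
have hs : has_rate (fun N => fps_subst
      (fun n => nested_sum d (fun i : 'I_(size ph) => e ph`_i) (fun i => (n i).+1) N)
      (fun i => l`_i) mu) (fps_subst (fun nu : multinom (size ph) => climit
       (nested_sum d (fun i : 'I_(size ph) => e ph`_i) (fun i => (nu i).+1)))
       (fun i => l`_i) mu).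
  apply: has_rate_sum => n _; rewrite mulrC.
  have := has_rateM (mcoeff mu (\prod_(i < size ph) l`_i ^+ (n : multinom _) i))
    (nested_sum_rate (n : multinom _) d_ge d_step elast).
  by apply: has_rate_ext => N; rewrite mulrC.
apply: has_rate_ext hs => N.
exact: (@fps_subst_nested_sum R m D d (size ph) (fun i => e ph`_i) (fun i => l`_i)).
Qed.

Let bden (M k : nat) : R[i] := (2 * (k%:Z - M%:Z) - 1)%:~R.

Lemma bdenl M k : (0 < k <= M)%N -> bden M (M.+1 - k) = - (2 * k - 1)%N%:R.
Proof.
move=> /andP[k0 kM]; rewrite /bden -[in RHS](rmorph_nat intr) -rmorphN /=; apply: congr1.
lia.
Qed.

Lemma bdenr M k : (0 < k <= M)%N -> bden M (k + M) = (2 * k - 1)%N%:R.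
Proof.
move=> /andP[k0 kM]; rewrite /bden -[in RHS](rmorph_nat intr) /=; apply: congr1.
lia.
Qed.

Lemma t_sum_rate (q : R[i]) p : cmod q = 1 -> q != 1 ->
  exists L, has_rate
    (fun M => \sum_(1 <= k < M.+1) q ^+ k / (2 * k - 1)%N%:R ^+ p.+1) L.
Proof.
move=> q1 qn1.
have [||L hL] := @chain_rate R (fun k => 2 * k - 1)%N _ _ 1
  (fun=> q) (fun=> p.+1) (fun=> q1) (fun=> ltn0Sn p) isT qn1.
- by move=> k; lia.
- by move=> k; lia.
exists L; apply: has_rate_ext hL => M.
by rewrite chain_prod_recr; apply: eq_bigr => k _; rewrite /chain_prod /= big_geq // mul1r.
Qed.

(** Folding by [k -> 1 - k] gives two one-sided sums, with [e phi] and [e (- phi)], to which Abel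
    summation applies. *)
Lemma Bt_fps_rate (phi : R) (nu : multinom 1) : e phi != 1 ->
  has_rate (fun M => \sum_(1 <= k < (M + M).+1)
      e ((k%:Z - M%:Z)%:~R * phi) / bden M k ^+ (nu ord0).+1) (Bt_fps phi nu).
Proof.
move=> e1; set q := nu ord0.
have eN1 : e (- phi) != 1 by rewrite eN invr_eq1.
have [L1 h1] := t_sum_rate q (cmod_e phi) e1.
have [L2 h2] := t_sum_rate q (cmod_e (- phi)) eN1.
pose F M k := e ((k%:Z - M%:Z)%:~R * phi) / bden M k ^+ q.+1.
have FE M : \sum_(1 <= k < (M + M).+1) F M k =
    (e phi * (-1) ^+ q.+1) * (\sum_(1 <= k < M.+1) e (- phi) ^+ k / (2 * k - 1)%N%:R ^+ q.+1) +
    \sum_(1 <= k < M.+1) e phi ^+ k / (2 * k - 1)%N%:R ^+ q.+1.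
  rewrite sum_center mulr_sumr; congr (_ + _); apply: eq_big_nat => k /andP[k0 kM].
    rewrite /F bdenl ?k0 // [in LHS]exprNn invfM.
    have -> : ((-1) ^+ q.+1)^-1 = (-1) ^+ q.+1 :> R[i] by rewrite -exprVn invrN1.
    have -> : ((M.+1 - k)%N%:Z - M%:Z)%:~R * phi = phi + k%:R * - phi.
      rewrite (_ : (M.+1 - k)%N%:Z - M%:Z = 1 - k%:Z); last by lia.
      by rewrite intrB mulrBl mul1r mulrN.
    by rewrite eD eMn; ring.
  rewrite /F bdenr ?k0 // (_ : (k + M)%N%:Z - M%:Z = k%:Z); last by lia.
  by rewrite -eMn.
have hL : has_rate (fun M => \sum_(1 <= k < (M + M).+1) F M k)
    (e phi * (-1) ^+ q.+1 * L2 + L1).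
  by apply: has_rate_ext (has_rateD (has_rateM _ h2) h1) => M; rewrite FE.
(* [Bt_fps] sums over [[-M, M]] but the chains over [(-M, M]]: the extra term at [-M] tends to 0. *)
have h0 : has_rate (fun M => F M 0%N) 0.
  exists 1 => M; rewrite subr0 mul1r /F cmodM cmod_e mul1r cmodV cmodX.
  have -> : bden M 0 = - (2 * M + 1)%N%:R.
    rewrite /bden -[in RHS](rmorph_nat intr) -rmorphN /=; apply: congr1; lia.
  rewrite cmodN cmod_nat; apply: (@le_trans _ _ (M.+1%:R^-1)).
    rewrite lef_pV2 ?posrE ?exprn_gt0 ?ltr0n ?addn1 // -natrX ler_nat.
    by apply: (@leq_trans ((2 * M).+1 ^ 1)); [lia|rewrite leq_pexp2l].
  by rewrite -isqrt_sqr expr2 ler_piMl ?isqrt_ge0 // isqrt_le1.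
suff -> : Bt_fps phi nu = e phi * (-1) ^+ q.+1 * L2 + L1 by [].
apply: has_rate_climit; rewrite -[_ + L1]add0r.
apply: has_rate_ext (has_rateD h0 hL) => M.
by rewrite -(big_mkord xpredT (F M)) mul2n -addnn [RHS]big_ltn.
Qed.

Lemma Bt_rate m D (phi : R) (l : mpoly m R[i]) (mu : multinom m) :
    e phi != 1 -> mcoeff (@mnm0 m) l = 0 -> (mdeg mu <= D)%N ->
  has_rate (fun M => mcoeff mu (\sum_(1 <= k < (M + M).+1)
      e ((k%:Z - M%:Z)%:~R * phi) *: geo D (bden M k) l)) (Bt phi l mu).
Proof.
move=> e1 l0 lD.
have hs : has_rate (fun M => fps_subst (fun n : multinom 1 =>
    \sum_(1 <= k < (M + M).+1) e ((k%:Z - M%:Z)%:~R * phi) / bden M k ^+ (n ord0).+1)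
    (fun=> l) mu) (Bt phi l mu).
  apply: has_rate_sum => n _; rewrite mulrC.
  have := has_rateM (mcoeff mu (\prod_(i < 1) l ^+ (n : multinom _) i))
    (Bt_fps_rate (n : multinom _) e1).
  by apply: has_rate_ext => N; rewrite mulrC.
by apply: has_rate_ext hs => N; apply: fps_subst_bilateral.
Qed.

End SeriesLimits.

(** * Limits of products of series *)

Section ProductLimits.
Variables (R : realType) (m : nat).
Local Notation C := (R[i] : numFieldType).
Implicit Types (l : mpoly m R[i]) (mu nu : multinom m).

Lemma eq_chain_poly D d k (eps eps' : nat -> R[i]) (l l' : nat -> mpoly m R[i]) N :
    (forall i, (i < k)%N -> eps i = eps' i) ->
    (forall i, (i < k)%N -> l i = l' i) ->
  chain_poly D d k eps l N = chain_poly D d k eps' l' N.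
Proof.
by move=> ee ll; apply: eq_chain_prod => i j lik _; rewrite (ee i lik) (ll i lik).
Qed.

(** For [|c| >= 1] every power [c^(-n-1)] in [geo] is at most [1 / |c|], so [K] can be chosen before
    [w] and [c]: it serves all pivots at once. *)
Lemma cmod_geo_le D l mu : exists K : R, forall (w c : R[i]),
  cmod w = 1 -> 1 <= cmod c -> cmod (mcoeff mu (w *: geo D c l)) <= K * (cmod c)^-1.
Proof.
exists (\sum_(n < D.+1) cmod (mcoeff mu (l ^+ n))) => w c w1 c1.
rewrite mcoeffZ cmodM w1 mul1r /geo raddf_sum /=.
apply: le_trans (cmod_sum _ _ _) _; rewrite mulr_suml; apply: ler_sum => n _.
rewrite mcoeffZ cmodM mulrC ler_wpM2l ?cmod_ge0 // cmodV cmodX.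
have c0 : 0 < cmod c by apply: lt_le_trans c1.
by rewrite lef_pV2 ?posrE ?exprn_gt0 // -{1}[cmod c]expr1 ler_weXn2l.
Qed.

Lemma fps_mul_cvg nu (X Y : nat -> mpoly m R[i]) (FX FY : fps R[i] m) :
    (forall mu, (mdeg mu <= mdeg nu)%N -> has_rate (fun M => mcoeff mu (X M)) (FX mu)) ->
    (forall mu, (mdeg mu <= mdeg nu)%N -> has_rate (fun M => mcoeff mu (Y M)) (FY mu)) ->
  ((fun M => mcoeff nu (X M * Y M) : C) @ \oo --> (fps_mul FX FY nu : C))%classic.
Proof.
move=> hX hY; rewrite (_ : (fun M => _) = fun M => \sum_(ab : bmultinom m (mdeg nu).+1 *
    bmultinom m (mdeg nu).+1 | nu == mnm_add ab.1 ab.2)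
    mcoeff ab.1 (X M) * mcoeff ab.2 (Y M)); last first.
  by apply: funext => M; rewrite mcoeffM.
apply: cvg_bigsum => -[[a la] [b lb]] _ /=.
exact: (cvgM (has_rate_cvg (hX a la)) (has_rate_cvg (hY b lb))).
Qed.

(** The three factors are coupled through the pivot, so the limit cannot be taken in each
    separately. For fixed monomials, the sum over [k] fits [convolution_cvg], a coefficient of the
    middle factor being the weight. *)
Lemma fps_mul3_cvg nu (X Y : nat -> mpoly m R[i]) (FX FY : fps R[i] m) (phi : R) l :
    (forall mu, (mdeg mu <= mdeg nu)%N -> has_rate (fun M => mcoeff mu (X M)) (FX mu)) ->
    (forall mu, (mdeg mu <= mdeg nu)%N -> has_rate (fun M => mcoeff mu (Y M)) (FY mu)) ->
    e phi != 1 -> mcoeff (@mnm0 m) l = 0 ->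
  ((fun M => mcoeff nu (\sum_(1 <= k < (M + M).+1) X k.-1 *
      (e ((k%:Z - M%:Z)%:~R * phi) *: geo (mdeg nu) (2 * (k%:Z - M%:Z) - 1)%:~R l) *
      Y (M + M - k)%N) : C)
    @ \oo --> (fps_mul (fps_mul FX (Bt phi l)) FY nu : C))%classic.
Proof.
move=> hX hY e1 l0.
pose G M k := e ((k%:Z - M%:Z)%:~R * phi) *: geo (mdeg nu) (2 * (k%:Z - M%:Z) - 1)%:~R l.
rewrite (_ : (fun M => _) = fun M =>
  \sum_(ab : bmultinom m (mdeg nu).+1 * bmultinom m (mdeg nu).+1 | nu == mnm_add ab.1 ab.2)
    \sum_(cd : bmultinom m (mdeg ab.1).+1 * bmultinom m (mdeg ab.1).+1 |
        (ab.1 : multinom m) == mnm_add cd.1 cd.2)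
      \sum_(1 <= k < (M + M).+1)
        mcoeff cd.1 (X k.-1) * mcoeff cd.2 (G M k) * mcoeff ab.2 (Y (M + M - k)%N)); last first.
  apply: funext => M; rewrite raddf_sum /=.
  under eq_bigr => k _ do rewrite mcoeffM.
  rewrite exchange_big /=; apply: eq_bigr => ab _.
  under eq_bigr => k _ do rewrite mcoeffM mulr_suml.
  by rewrite exchange_big.
apply: cvg_bigsum => -[[a la] [b lb]] /= _; rewrite mulr_suml.
apply: cvg_bigsum => -[[c lc] [d ld]] /= _.
have la' : (mdeg a <= mdeg nu)%N by [].
have ld' : (mdeg d <= mdeg nu)%N by apply: leq_trans la'; rewrite -ltnS.
have lc' : (mdeg c <= mdeg nu)%N by apply: leq_trans la'; rewrite -ltnS.
have [K hK] := cmod_geo_le (mdeg nu) l d.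
have hG M k j : (0 < j)%N -> cmod (2 * (k%:Z - M%:Z) - 1)%:~R = (2 * j - 1)%N%:R :> R ->
    cmod (mcoeff d (G M k)) <= K * j%:R^-1.
  move=> j0 cE; have c1 : 1 <= cmod (2 * (k%:Z - M%:Z) - 1)%:~R :> R.
    by rewrite cE ler1n; lia.
  have K0 : 0 <= K.
    have := hK 1 1; rewrite cmod1 invr1 mulr1 => /(_ erefl (lexx _)).
    exact: le_trans (cmod_ge0 _).
  apply: le_trans (hK _ _ (cmod_e _) c1) _; rewrite ler_wpM2l // cE.
  by rewrite lef_pV2 ?posrE ?ltr0n ?ler_nat //; lia.
apply: (@convolution_cvg R (fun M k => mcoeff d (G M k))
  (fun M => mcoeff c (X M)) (fun M => mcoeff b (Y M)) (FX c) (FY b) (Bt phi l d) K).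
- exact: hX.
- exact: hY.
- by move=> M k k0M; apply: hG; [case/andP: k0M|rewrite bdenl // cmodN cmod_nat].
- by move=> M k k0M; apply: hG; [case/andP: k0M|rewrite bdenr // cmod_nat].
apply: has_rate_cvg; apply: has_rate_ext (Bt_rate e1 l0 ld') => M.
by rewrite raddf_sum.
Qed.

Lemma mcoeff0_nth (s : seq (mpoly m R[i])) :
    (forall z, z \in s -> mcoeff (@mnm0 m) z = 0) ->
  forall i, mcoeff (@mnm0 m) s`_i = 0.
Proof.
move=> h i; have [lis|sli] := ltnP i (size s); first exact/h/mem_nth.
by rewrite nth_default // mcoeff0.
Qed.

Lemma mcoeff0_yvars z : z \in yvars R[i] m -> mcoeff (@mnm0 m) z = 0.
Proof.
case/mapP => i _ ->; rewrite mcoeffX; apply/eqP; rewrite pnatr_eq0 eqb0.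
by apply/eqP => /(congr1 (@mdeg m)); rewrite mdeg0 mdeg1.
Qed.

End ProductLimits.

Lemma nth_rev_map_take (S T : Type) (x0 : S) (y0 : T) (h : S -> T) s j i :
  (i < j <= size s)%N ->
  nth y0 (rev [seq h x | x <- take j s]) i = h (nth x0 s (j - i.+1)).
Proof.
move=> /andP[lij js]; have st : size (take j s) = j by rewrite size_take_min; lia.
rewrite nth_rev size_map st // (nth_map x0) ?st ?nth_take //; lia.
Qed.

Lemma size_rev_map_take (S T : Type) (h : S -> T) s j : (j <= size s)%N ->
  size (rev [seq h x | x <- take j s]) = j.
Proof. by move=> js; rewrite size_rev size_map size_take_min; lia. Qed.

Lemma sum_take (V : nmodType) (s : seq V) j : (j <= size s)%N ->
  \sum_(x <- take j s) x = \sum_(0 <= i < j) s`_i.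
Proof.
move=> js; rewrite (big_nth 0) size_take_min (minn_idPl js).
by apply: eq_big_nat => i /andP[_ lij]; rewrite nth_take.
Qed.

Lemma odd_ge k : (k <= 2 * k - 1)%N.
Proof. lia. Qed.

Lemma odd_step k : (0 < k)%N -> (2 * k - 1 <= 2 * k.+1 - 1 <= 2 * k - 1 + 2)%N.
Proof. lia. Qed.

Lemma id_step k : (0 < k)%N -> (id k <= id k.+1 <= id k + 2)%N.
Proof. by move=> _ /=; lia. Qed.

Lemma e_neq1 (R : realType) (x : R) : x \isn't a Num.int -> e x != 1.
Proof. by apply: contra => /eqP/e_eq1. Qed.

(* In the second sum, i : 'I_m is the 0-based index j - 1. *)
Theorem mainTheorem12 (R : realType) (m : nat) (phi : m.-tuple R)
    (m_gt0 : (0 < m)%N)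
    (phi_first : phi`_0 \isn't a Num.int)
    (phi_last : phi`_m.-1 \isn't a Num.int)
    (phi_sum : \sum_(x <- phi) x \isn't a Num.int) :
  let y : seq (mpoly m R[i]) := yvars R[i] m in
  forall nu : multinom m,
    \sum_(j < m.+1)
       (-1) ^+ j * e (\sum_(x <- take j phi) x) *
       fps_mul (Lit (drop j phi) (drop j y))
               (Lit (rev [seq - x | x <- take j phi])
                    (rev [seq - z | z <- take j y])) nu
    = (2 ^+ m.-1)^-1 *
      \sum_(i < m)
         (-1) ^+ i *
         fps_mul
           (fps_mul (Li (rev [seq - x | x <- take i phi])
                        (rev [seq 2^-1 *: (y`_i - z) | z <- take i y]))
                    (Bt (\sum_(x <- phi) x) y`_i))
           (Li (drop i.+1 phi)
               [seq 2^-1 *: (z - y`_i) | z <- drop i.+1 y]) nu.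
Proof.
case: m phi m_gt0 phi_first phi_last phi_sum => // n phi _ phi_first phi_last phi_sum y nu.
have sphi : size phi = n.+1 by rewrite size_tuple.
have sy : size y = n.+1 by rewrite size_map size_enum_ord.
have y0 i : mcoeff (@mnm0 n.+1) y`_i = 0 by apply: mcoeff0_nth => z; apply: mcoeff0_yvars.
(* The conditions for Abel summation: a nonempty tail of [phi] ends with [phi_m], a nonempty
   reversed and negated head with [- phi_1]. *)
have drop_last j : (0 < size (drop j phi))%N ->
    e (drop j phi)`_(size (drop j phi)).-1 != 1.
  rewrite size_drop sphi nth_drop => jn; apply: e_neq1.
  by rewrite (_ : (j + _)%N = n.+1.-1) //=; lia.
have take_last j : (j <= n.+1)%N ->
    let s := rev [seq - x | x <- take j phi] in (0 < size s)%N -> e s`_(size s).-1 != 1.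
  move=> jn s; rewrite /s size_rev_map_take ?sphi // => j0.
  rewrite (nth_rev_map_take 0) ?sphi; last by lia.
  rewrite (_ : (j - _)%N = 0%N); last by lia.
  by rewrite eN invr_eq1 e_neq1.
have drop_y0 j z : z \in drop j y -> mcoeff (@mnm0 n.+1) z = 0.
  by move/mem_drop/mcoeff0_yvars.
have take_y0 j z : z \in take j y -> mcoeff (@mnm0 n.+1) z = 0.
  by move/mem_take/mcoeff0_yvars.
(* Truncating at degree [mdeg nu] is enough: products contribute to this coefficient only through
   coefficients of degree at most [mdeg nu]. *)
pose u M : R[i] := mcoeff nu (chain_prod 0 (M + M) n.+1
  (bilateral_factor (mdeg nu) M (nth 0 phi) (nth 0 y))).
transitivity (climit u); [apply/esym|]; apply: climit_eq.
  rewrite (_ : u = fun M => \sum_(j < n.+2) (-1) ^+ j * e (\sum_(x <- take j phi) x) *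
     mcoeff nu (
       chain_poly (mdeg nu) (fun k => 2 * k - 1)%N (size (drop j phi))
         (fun i => e (drop j phi)`_i) (fun i => (drop j y)`_i) M *
       chain_poly (mdeg nu) (fun k => 2 * k - 1)%N (size (rev [seq - x | x <- take j phi]))
         (fun i => e (rev [seq - x | x <- take j phi])`_i)
         (fun i => (rev [seq - z | z <- take j y])`_i) M)); last first.
    apply: funext => M; rewrite /u bilateral_split raddf_sum /=; apply: eq_bigr => j _.
    have jn : (j <= n.+1)%N by rewrite -ltnS.
    rewrite mcoeffZ sum_take ?sphi //; apply: (congr1 (fun x => _ * mcoeff nu x)).
    rewrite size_drop size_rev_map_take; last by rewrite sphi.
    rewrite sphi (@eq_chain_poly _ _ _ _ _ _ (fun i => e (drop j phi)`_i) _
      (fun i => (drop j y)`_i)); first last.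
    - by move=> i _; rewrite nth_drop addnC.
    - by move=> i _; rewrite nth_drop addnC.
    apply: (congr1 (fun x => _ * x)); apply: eq_chain_poly => i lij.
      by rewrite (nth_rev_map_take 0) // sphi lij.
    by rewrite (nth_rev_map_take 0) // sy lij.
  apply: cvg_bigsum => j _; have jn : (j <= n.+1)%N by rewrite -ltnS.
  apply: cvgM; first exact: cvg_cst.
  apply: fps_mul_cvg => mu lmu.
    apply: (nested_fps_rate odd_ge odd_step) => //; first exact: drop_last.
    by apply: mcoeff0_nth => z; apply: drop_y0.
  apply: (nested_fps_rate odd_ge odd_step) => //.
    exact: take_last.
  by apply: mcoeff0_nth => z; rewrite mem_rev => /mapP[z' /take_y0 z0 ->]; rewrite mcoeffN z0 oppr0.
pose L (j : 'I_n.+1) M := chain_poly (mdeg nu) id (size (rev [seq - x | x <- take j phi]))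
  (fun i => e (rev [seq - x | x <- take j phi])`_i)
  (fun i => (rev [seq 2^-1 *: (y`_j - z) | z <- take j y])`_i) M.
pose S (j : 'I_n.+1) M := chain_poly (mdeg nu) id (size (drop j.+1 phi))
  (fun i => e (drop j.+1 phi)`_i)
  (fun i => [seq 2^-1 *: (z - y`_j) | z <- drop j.+1 y]`_i) M.
rewrite (_ : u = fun M => (2 ^+ n)^-1 * \sum_(j < n.+1) (-1) ^+ j *
   mcoeff nu (\sum_(1 <= k < (M + M).+1) L j k.-1 *
      (e ((k%:Z - M%:Z)%:~R * \sum_(x <- phi) x) *:
         geo (mdeg nu) (2 * (k%:Z - M%:Z) - 1)%:~R y`_j) *
      S j (M + M - k)%N)); last first.
  apply: funext => M; rewrite /u (bilateral_fractions _ _ _ y0) //.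
  rewrite mcoeffZ big_mkord raddf_sum /=; apply: (congr1 (fun x => _ * x)).
  apply: eq_bigr => j _; have jn : (j <= n)%N by rewrite -ltnS.
  have jn1 : (j <= n.+1)%N by apply: leqW.
  rewrite mcoeffZ; apply: (congr1 (fun x => _ * mcoeff nu x)).
  apply: eq_big_nat => k _.
  rewrite -sum_take; last by rewrite sphi.
  rewrite (take_oversize (n := n.+1)); last by rewrite sphi.
  have -> : L j k.-1 = chain_poly (mdeg nu) id j (fun i => e (- phi`_(j - i.+1)))
      (fun i => 2^-1 *: (y`_j - y`_(j - i.+1))) k.-1.
    rewrite /L size_rev_map_take; last by rewrite sphi.
    apply: eq_chain_poly => i lij.
      by rewrite (nth_rev_map_take 0) // sphi lij.
    by rewrite (nth_rev_map_take 0) // sy lij.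
  apply: (congr1 (fun x => _ * x)).
  rewrite /S size_drop sphi subSS; apply: eq_chain_poly => i lij.
    by rewrite nth_drop addnC.
  rewrite [RHS](nth_map 0); last by rewrite size_drop sy subSS.
  by rewrite nth_drop addnC.
apply: cvgM; first exact: cvg_cst.
apply: cvg_bigsum => j _; apply: cvgM; first exact: cvg_cst.
apply: fps_mul3_cvg => [mu lmu|mu lmu||]; last exact: y0; last exact: e_neq1.
  apply: (nested_fps_rate (d := id) (fun=> leqnn _) id_step) => //.
    by apply: take_last; apply: ltnW.
  apply: mcoeff0_nth => z; rewrite mem_rev => /mapP[z' /take_y0 z0 ->].
  by rewrite mcoeffZ mcoeffB y0 z0 subrr mulr0.
apply: (nested_fps_rate (d := id) (fun=> leqnn _) id_step) => //; first exact: drop_last.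
apply: mcoeff0_nth => z /mapP[z' /drop_y0 z0 ->].
by rewrite mcoeffZ mcoeffB y0 z0 subrr mulr0.
Qed.
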